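(* Let $\mathcal{P}$ be a hereditary property of posets. Then the following assertions hold. (a) If $|\mathcal{P}_n|$ is unbounded (as a function of $n$), then $|\mathcal{P}_n| \geq \lceil \frac{n+1}{2} \rceil$ for every $n \in \mathbb{N}$. (b) If also $|\mathcal{P}_n| - \lceil \frac{n+1}{2} \rceil$ is unbounded (as a function of $n$), then $|\mathcal{P}_n| \geq n$ for every $n \in \mathbb{N}$. Moreover, the lower bounds are best possible: there is a hereditary property of posets satisfying the hypothesis of (a) with $|\mathcal{P}_n| = \lceil \frac{n+1}{2} \rceil$ for every $n \in \mathbb{N}$, and there is a hereditary property of posets satisfying the hypotheses of (b) with $|\mathcal{P}_n| = n$ for every $n \in \mathbb{N}$.
   Context: All posets are finite and $\mathbb{N} = \{1,2,3,\ldots\}$. A hereditary property of posets is a collection $\mathcal{P}$ of finite posets that is closed under isomorphism, closed under taking induced subposets, and contains arbitrarily large posets. $\mathcal{P}_n$ denotes the collection of distinct (i.e., pairwise non-isomorphic) posets in $\mathcal{P}$ with exactly $n$ elements, so $|\mathcal{P}_n|$ is the number of isomorphism classes of $n$-element posets in $\mathcal{P}$. *)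

(* Defs.v *)
From HB Require Import structures.
From mathcomp Require Import all_boot all_order all_algebra.
From mathcomp Require Import boolp.

Set Implicit Arguments.
Unset Strict Implicit.
Unset Printing Implicit Defensive.

Import Order.TTheory GRing.Theory Num.Theory.

Definition subposet (d : Order.disp_t) (T : finPOrderType d) (A : {set T}) :=
  {x : T | x \in A}.

HB.instance Definition _ (d : Order.disp_t) (T : finPOrderType d)
  (A : {set T}) := Finite.on (subposet A).
HB.instance Definition _ (d : Order.disp_t) (T : finPOrderType d)
  (A : {set T}) := SubType.on (subposet A).
HB.instance Definition _ (d : Order.disp_t) (T : finPOrderType d)
  (A : {set T}) := [SubChoice_isSubPOrder of subposet A by <: with d].

Lemma le_subposetE (d : Order.disp_t) (T : finPOrderType d) (A : {set T})
  (x y : subposet A) : (x <= y)%O = (val x <= val y)%O.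
Proof. by []. Qed.

Definition poset_iso (d d' : Order.disp_t) (T : finPOrderType d)
    (T' : finPOrderType d') : Prop :=
  exists2 f : T -> T', bijective f & {mono f : x y / (x <= y)%O}.

(* Displays carry no mathematical content: closure under isomorphism below,
   which ranges over two displays, makes membership independent of them. *)
Definition poset_property := forall d : Order.disp_t, finPOrderType d -> Prop.

Record hereditary (P : poset_property) : Prop := Hereditary {
  hereditary_iso : forall (d d' : Order.disp_t) (T : finPOrderType d)
    (T' : finPOrderType d'), poset_iso T T' -> P d T -> P d' T';
  hereditary_sub : forall (d : Order.disp_t) (T : finPOrderType d)
    (A : {set T}), P d T -> P d (subposet A);
  hereditary_large : forall n : nat,
    exists (d : Order.disp_t) (T : finPOrderType d), P d T /\ n <= #|T|
}.

(* The isomorphism class of an n-element poset T is represented by the set of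
   all order relations on 'I_n obtained by labelling T with 'I_n; this makes
   the isomorphism classes of n-element posets elements of a finite type.
   See iso_class_eqP. *)
Definition iso_class (n : nat) (d : Order.disp_t) (T : finPOrderType d) :
    {set {set 'I_n * 'I_n}} :=
  [set r : {set 'I_n * 'I_n} | `[< exists2 f : 'I_n -> T, bijective f &
                 forall i j : 'I_n, ((i, j) \in r) = (f i <= f j)%O >]].

Lemma iso_class_eqP (n : nat) (d d' : Order.disp_t) (T : finPOrderType d)
    (T' : finPOrderType d') : #|T| = n ->
  iso_class n T = iso_class n T' <-> poset_iso T T'.
Proof.
move=> cT; split=> [eqC|[f bf fle]].
  have [f bf] : exists f : 'I_n -> T, bijective f.
    rewrite -cT; exists enum_val.
    by exists enum_rank; [exact: enum_valK | exact: enum_rankK].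
  pose r := [set p : 'I_n * 'I_n | (f p.1 <= f p.2)%O].
  have : r \in iso_class n T.
    by rewrite inE; apply/asboolP; exists f => // i j; rewrite inE.
  rewrite eqC inE => /asboolP[g bg rg]; have [h fK hK] := bf.
  exists (g \o h); first by apply: bij_comp => //; exists f.
  by move=> x y; rewrite /= -rg inE /= !hK.
have [g fK gK] := bf; have bg : bijective g by exists f.
apply/setP=> r; rewrite !inE; apply/asboolP/asboolP => -[h bh rh].
  by exists (f \o h) => [|i j]; [exact: bij_comp | rewrite /= fle].
exists (g \o h) => [|i j]; first exact: bij_comp.
by rewrite /= -fle !gK.
Qed.

Definition iso_classes (P : poset_property) (n : nat) :
    {set {set {set 'I_n * 'I_n}}} :=
  [set C : {set {set 'I_n * 'I_n}} | `[< exists (d : Order.disp_t) (T : finPOrderType d),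
                 [/\ P d T, #|T| = n & C = iso_class n T] >]].

Definition speed (P : poset_property) (n : nat) : nat := #|iso_classes P n|.

(* Integer-valued, so that differences are not truncated; n ranges over the
   positive integers. *)
Definition unbounded (u : nat -> int) : Prop :=
  forall M : nat, exists2 n : nat, 0 < n & M < `|u n|%N.

(* Main.v *)
From HB Require Import structures.
Require Import Defs.
From mathcomp Require Import all_boot all_order all_algebra.
From mathcomp Require Import boolp zify.

Set Implicit Arguments.
Unset Strict Implicit.
Unset Printing Implicit Defensive.

Import Order.TTheory.

(** Lower bounds on the speed come from configurations. Some of them, once they
    occur in a single member of the property with parts of size n, contain n
    pairwise non-isomorphic n-element subposets: an antichain all of whose
    elements lie on the same side of n further elements; an antichain and a
    chain with no comparability between them; an antichain or a chain of which a
    point has n elements on one side of it and is incomparable to n others; a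
    chain with a point that is incomparable to one of its elements and has n
    elements of it below and n above. Two further configurations yield only
    n./2.+1 = uphalf n.+1 subposets: an induced matching of comparabilities,
    through k two-element chains plus n - 2k isolated points, and two unrelated
    chains, through chains of k and n - k elements.

    Let speed P n < n, so that the configurations of the first kind are absent
    in size n from all members of P. Then [module_or_half_family] gives, for
    every m, a constant L such that each member of P contains a large matching
    or two large unrelated chains, or else is made of a chain or an antichain M
    with at most L other points, none of which tells two points of M apart.
    Indeed a long chain and a big antichain cannot coexist, and if the chains
    have bounded size then, A being a maximum antichain, either the complement
    of A is bounded, by Mirsky's theorem, or it contains a big antichain; up to
    few elements, the comparabilities between that antichain and A form a
    bipartite graph of bounded degree, which contains a big induced matching. If
    the antichains have bounded size, a similar argument with a maximum chain
    gives two unrelated chains.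

    Up to isomorphism, a poset of the last sort is determined by its size and a
    code in a finite set that depends on L only [module_code]. If speed P n <=
    n./2 then neither of the two half families occurs in size n, whence all
    members are of this sort and the speed is bounded; this proves (a).

    For (b), a few points that destroy the shape of a large matching or of two
    large chains yield (n.-1)./2 classes besides the n./2.+1 classes of the half
    family, which makes n in total; so do a large matching and two large chains
    in two members of P. Hence, when speed P n < n, the members with a large
    matching are exactly matchings [matching_exact], or else the members with
    two large chains are exactly unions of two chains [two_chains_exact], and
    only one of the two cases occurs in P. Such posets have at most m./2.+1
    isomorphism types in size m, so that speed P m - uphalf m.+1 is bounded.

    The bounds are attained by the disjoint unions of two chains, determined by
    the size of the smaller chain, and by the ordinal sums of two antichains. *)

(** * Order relations, chains and antichains *)

Notation cmp x y := (x >=< y)%O.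

Section OrderBasics.
Context {d : Order.disp_t} {T : finPOrderType d}.
Implicit Types (x y z : T) (A B C S X : {set T}) (f : bool).

(** The order or its dual, according to a flag: every configuration and every
    argument below then also covers its order dual. *)
Definition dlt f x y := if f then (x < y)%O else (y < x)%O.

Definition chain C := {in C &, forall x y, cmp x y}.
Definition antichain A := {in A &, forall x y, cmp x y -> x = y}.
Definition unrelated A B := {in A & B, forall x y, ~~ cmp x y}.

Lemma cmp_sym x y : cmp x y = cmp y x.
Proof. exact: comparable_sym. Qed.

Lemma dlt_trans f y x z : dlt f x y -> dlt f y z -> dlt f x z.
Proof. by case: f => /= h1 h2; [apply: lt_trans h2 | apply: lt_trans h1]. Qed.

Lemma dltxx f x : dlt f x x = false.
Proof. by case: f; rewrite /= ltxx. Qed.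

Lemma dltN f x y : dlt (~~ f) x y = dlt f y x.
Proof. by case: f. Qed.

Lemma dlt_asym f x y : dlt f x y -> dlt f y x = false.
Proof. by move=> h; apply/negP => /(dlt_trans h); rewrite dltxx. Qed.

Lemma dlt_neq f x y : dlt f x y -> x != y.
Proof. by case: eqP => // ->; rewrite dltxx. Qed.

Lemma dlt_cmp f x y : dlt f x y -> cmp x y.
Proof.
by case: f => /= /ltW h; [apply: le_comparable | rewrite cmp_sym le_comparable].
Qed.

Lemma dlt_cmpr f x y : dlt f x y -> cmp y x.
Proof. by rewrite cmp_sym => /dlt_cmp. Qed.

Lemma cmp_dlt f x y : cmp x y = [|| x == y, dlt f x y | dlt f y x].
Proof.
apply/idP/or3P => [|[/eqP->|/dlt_cmp|/dlt_cmpr] //]; last exact: comparablexx.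
rewrite /Order.comparable !le_eqVlt (eq_sym y).
by case/orP=> /orP[h|h]; [apply: Or31 | | apply: Or31 | ] => //;
  case: f; rewrite /= ?h; [apply: Or32|apply: Or33|apply: Or33|apply: Or32].
Qed.

Lemma chainS C C' : C' \subset C -> chain C -> chain C'.
Proof. by move=> /subsetP s h x y /s hx /s hy; apply: h. Qed.

Lemma antichainS A A' : A' \subset A -> antichain A -> antichain A'.
Proof. by move=> /subsetP s h x y /s hx /s hy; apply: h. Qed.

Lemma unrelatedS A A' B B' : A' \subset A -> B' \subset B ->
  unrelated A B -> unrelated A' B'.
Proof. by move=> /subsetP s /subsetP s' h x y /s hx /s' hy; apply: h. Qed.

Lemma unrelated_sym A B : unrelated A B -> unrelated B A.
Proof. by move=> h x y hx hy; rewrite cmp_sym h. Qed.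

Lemma unrelated_disjoint A B : unrelated A B -> [disjoint A & B].
Proof.
move=> h; rewrite disjoints_subset; apply/subsetP=> x xA; rewrite inE.
by apply/negP=> xB; have := h _ _ xA xB; rewrite comparablexx.
Qed.

Lemma antichain_dlt f A x y : antichain A -> x \in A -> y \in A ->
  dlt f x y = false.
Proof.
move=> aA xA yA; apply/negP => h; have := dlt_neq h.
by rewrite (aA x y) ?eqxx // (dlt_cmp h).
Qed.

Lemma antichainU A B : antichain A -> antichain B -> unrelated A B ->
  antichain (A :|: B).
Proof.
move=> aA aB uAB x y; rewrite !inE => /orP[hx|hx] /orP[hy|hy].
- exact: aA.
- by move=> h; have := uAB _ _ hx hy; rewrite h.
- by rewrite cmp_sym => h; have := uAB _ _ hy hx; rewrite h.
- exact: aB.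
Qed.

Lemma chainU A B : chain A -> chain B -> {in A & B, forall x y, cmp x y} ->
  chain (A :|: B).
Proof.
move=> aA aB h x y; rewrite !inE => /orP[hx|hx] /orP[hy|hy].
- exact: aA.
- exact: h.
- by rewrite cmp_sym h.
- exact: aB.
Qed.

Lemma chain1 x : chain [set x].
Proof. by move=> y z /set1P-> /set1P->; exact: comparablexx. Qed.

Lemma chain_dlt f C x y : chain C -> x \in C -> y \in C -> x != y ->
  ~~ dlt f x y -> dlt f y x.
Proof.
move=> cC xC yC n1 n2; have := cC _ _ xC yC.
by rewrite (cmp_dlt f) (negPf n1) (negPf n2).
Qed.

Definition below f C x := [set y in C | dlt f y x].

Lemma below_proper f C x y : x \in C -> dlt f x y ->
  below f C x \proper below f C y.
Proof.
move=> xC h; apply/properP; split; last by exists x; rewrite !inE xC ?dltxx.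
by apply/subsetP=> z; rewrite !inE => /andP[-> /dlt_trans]; apply.
Qed.

(** Ranks identify a chain with an initial segment of the natural numbers. *)
Lemma chain_rank C x y : chain C -> x \in C -> y \in C ->
  (x <= y)%O = (#|below true C x| <= #|below true C y|).
Proof.
move=> cC xC yC; apply/idP/idP.
  rewrite le_eqVlt => /orP[/eqP->//|h].
  by apply/ltnW/proper_card/below_proper.
apply: contraTT => h; rewrite -ltnNge; apply/proper_card/below_proper => //=.
by move: (cC _ _ xC yC); rewrite (comparable_ltNge (cC _ _ yC xC)).
Qed.

Lemma below_lt f C x : x \in C -> #|below f C x| < #|C|.
Proof.
move=> xC; apply/proper_card/properP; split.
  by apply/subsetP=> y; rewrite inE => /andP[].
by exists x => //; rewrite inE dltxx andbF.
Qed.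

Lemma chain_rank_inj f C : chain C ->
  {in C &, injective (fun x => #|below f C x|)}.
Proof.
move=> cC x y xC yC e; apply/eqP; apply/negPn/negP => n.
have /orP[h|h] : dlt f x y || dlt f y x.
  by have := cC _ _ xC yC; rewrite (cmp_dlt f) (negPf n).
- by have := proper_card (below_proper xC h); rewrite e ltnn.
- by have := proper_card (below_proper yC h); rewrite e ltnn.
Qed.

Lemma chain_low f C k : chain C ->
  #|[set x in C | #|below f C x| < k]| <= k.
Proof.
move=> cC; rewrite -[leqRHS]card_ord.
case: k => [|k]; first by rewrite eq_card0 ?card_ord // => x;
  rewrite !inE ltn0 andbF.
apply: (@leq_card_in _ _ (fun x => inord #|below f C x| : 'I_k.+1)).
move=> x y; rewrite !inE => /andP[xC hx] /andP[yC hy] /(congr1 val) /=.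
by rewrite !inordK //; apply: chain_rank_inj.
Qed.

Lemma chain_min C x0 : chain C -> x0 \in C ->
  exists2 c, c \in C & {in C, forall y, (c <= y)%O}.
Proof.
move=> cC x0C; case: (arg_minnP (fun x => #|below true C x|) x0C) => c cC' h.
by exists c => // y yC; rewrite (chain_rank cC) // h.
Qed.

(** Mirsky's theorem. The minimal elements of X form an antichain; removing them
    k times exhausts X unless some element survives, and a survivor has a chain
    of k elements below it. *)
Lemma mirsky X w k : (forall A, A \subset X -> antichain A -> #|A| <= w) ->
  (exists C, [/\ C \subset X, chain C & #|C| = k.+1]) \/ #|X| <= k * w.
Proof.
elim: k X => [|k IH] X hw.
  case: (set_0Vmem X) => [->|[x xX]]; first by right; rewrite cards0.
  by left; exists [set x]; rewrite sub1set cards1; split => //; exact: chain1.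
(* Y is X without its minimal elements. *)
pose Y := [set x in X | [exists y in X, (y < x)%O]].
have sYX : Y \subset X by apply/subsetP=> x; rewrite inE => /andP[].
have [|[C [sC cC hC]]|hY] := IH Y.
- by move=> A sA; apply: hw; apply: subset_trans sYX.
- have /card_gt0P[x0 x0C] : 0 < #|C| by rewrite hC.
  have [c cc hc] := chain_min cC x0C.
  have := subsetP sC _ cc; rewrite inE => /andP[cX /existsP[y /andP[yX yc]]].
  left; exists (y |: C); split.
  + by rewrite subUset sub1set yX (subset_trans sC).
  + apply: chainU => // [|u v /set1P-> vC]; first exact: chain1.
    by apply/le_comparable/ltW/(lt_le_trans yc)/hc.
  + rewrite cardsU1 hC (_ : y \notin C) //; apply/negP=> yC.
    by have := lt_le_trans yc (hc _ yC); rewrite ltxx.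
- right; have -> : #|X| = #|X :\: Y| + #|Y|.
    by rewrite -(cardsID Y X) addnC (setIidPr sYX).
  rewrite mulSn leq_add //; apply: hw; first exact: subsetDl.
  have mn x y : x \in X :\: Y -> y \in X -> ~~ (y < x)%O.
    rewrite !inE => /andP[nY xX] yX; rewrite xX /= in nY.
    by apply: contra nY => h; apply/existsP; exists y; rewrite yX.
  move=> x y hx hy; have [xX yX] : x \in X /\ y \in X.
    by move: hx hy; rewrite !inE => /andP[_ ->] /andP[_ ->].
  rewrite (cmp_dlt true) /= => /or3P[/eqP//|h|h].
  - by have := mn _ _ hy xX; rewrite h.
  - by have := mn _ _ hx yX; rewrite h.
Qed.

End OrderBasics.

Lemma subset_of_card (T : finType) (A : {set T}) k : k <= #|A| ->
  exists2 B : {set T}, B \subset A & #|B| = k.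
Proof.
case/card_geqP=> s [us sz sA]; exists [set x in s].
  by apply/subsetP=> x; rewrite inE => /sA.
by rewrite cardsE (card_uniqP us).
Qed.

Lemma subset_of_card2 (T : finType) (A : {set T}) k l : k + l <= #|A| ->
  exists B1 B2 : {set T}, [/\ B1 \subset A, B2 \subset A, [disjoint B1 & B2],
    #|B1| = k & #|B2| = l].
Proof.
move=> h; have [B1 s1 c1] := @subset_of_card _ A k ltac:(lia).
have [|B2 s2 c2] := @subset_of_card _ (A :\: B1) l.
  by have := cardsID B1 A; rewrite (setIidPr s1); lia.
exists B1, B2; split => //; first exact: subset_trans s2 (subsetDl _ _).
rewrite disjoint_sym disjoints_subset; apply: subset_trans s2 _.
by apply/subsetP=> x; rewrite !inE => /andP[].
Qed.

(** The union bound by which exceptional elements are discarded throughout. *)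
Lemma avoid_nbrs (T I : finType) (A : {set T}) (B : {set I}) (F : I -> {set T})
    t s : {in B, forall b, #|F b| <= t} -> #|B| * t + s <= #|A| ->
  s <= #|A :\: \bigcup_(b in B) F b|.
Proof.
move=> hF hA; have hU : #|\bigcup_(b in B) F b| <= #|B| * t.
  rewrite -sum_nat_const; elim/big_rec2: _ => [|i n V iB IH];
    rewrite ?cards0 //.
  by apply: leq_trans (leq_card_setU _ _) _; rewrite leq_add // hF.
have := cardsID (\bigcup_(b in B) F b) A.
by have := subset_leq_card (subsetIr A (\bigcup_(b in B) F b)); lia.
Qed.

Lemma leq_cardsU (T : finType) (A B : {set T}) : #|A :|: B| <= #|A| + #|B|.
Proof. by have [] := leq_card_setU A B. Qed.

Lemma leq_cardsD (T : finType) (A B : {set T}) : #|A| <= #|A :\: B| + #|B|.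
Proof.
by rewrite -(cardsID B A) addnC leq_add2l subset_leq_card // subsetIr.
Qed.

(** * Invariants and lower bounds on the speed *)

(** Invariants are functions of a subset A of a poset that depend only on the
    induced order on A; this is how a family of subsets of one large poset is
    shown to represent different isomorphism classes. *)
Definition embedding_invariant (W : Type)
    (phi : forall (d : Order.disp_t) (T : finPOrderType d), {set T} -> W) :=
  forall (d d' : Order.disp_t) (T : finPOrderType d) (T' : finPOrderType d')
    (h : T -> T'), {mono h : x y / (x <= y)%O} ->
  forall A : {set T}, phi d' T' (h @: A) = phi d T A.

Lemma mono_inj (d d' : Order.disp_t) (T : finPOrderType d)
  (T' : finPOrderType d') (h : T -> T') :
  {mono h : x y / (x <= y)%O} -> injective h.
Proof.
by move=> m x y e; apply/le_anti; rewrite -!m e lexx.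
Qed.

Lemma mono_cmp (d d' : Order.disp_t) (T : finPOrderType d)
  (T' : finPOrderType d') (h : T -> T') :
  {mono h : x y / (x <= y)%O} -> {mono h : x y / cmp x y}.
Proof. by move=> m x y; rewrite /Order.comparable !m. Qed.

Lemma mono_dlt (d d' : Order.disp_t) (T : finPOrderType d)
  (T' : finPOrderType d') (h : T -> T') f :
  {mono h : x y / (x <= y)%O} -> {mono h : x y / dlt f x y}.
Proof.
by move=> m x y; case: f; rewrite /dlt !lt_leAnge !m.
Qed.

Lemma exists_imset (T T' : finType) (h : T -> T') (A : {set T}) (p : pred T') :
  [exists y in h @: A, p y] = [exists x in A, p (h x)].
Proof.
apply/existsP/existsP => [[y /andP[/imsetP[x xA ->] px]]|[x /andP[xA px]]].
  by exists x; rewrite xA.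
by exists (h x); rewrite imset_f.
Qed.

Lemma eq_exists_in (T : finType) (A : {set T}) (p q : pred T) : p =1 q ->
  [exists x in A, p x] = [exists x in A, q x].
Proof. by move=> e; apply: eq_existsb => x; rewrite e. Qed.

Section Invariants.
Context {d : Order.disp_t} {T : finPOrderType d}.
Implicit Types (x y z : T) (A B C S X : {set T}) (f : bool).

Definition nonextremal f S := \sum_(x in S) [exists y in S, dlt f x y].

(** Ordered pairs, those on the diagonal of A and B included, so that a chain of
    k elements contributes k * k and an antichain contributes its size. *)
Definition cmp_pairs A B := \sum_(x in A) \sum_(y in B) cmp x y.

(** Size of the down-set generated by the elements that have an incomparable
    partner. In an ordinal sum of a chain of k elements, two incomparable points
    and another chain it is k + 2, whereas the total number of comparable pairs
    does not depend on k. *)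
Definition below_incomparable S :=
  \sum_(x in S) [exists y in S, [exists z in S, ~~ cmp y z && (x <= y)%O]].

(** The components of the comparability graph have at most two elements exactly
    when this fails. *)
Definition branching S := [exists x in S, [exists y in S, [exists z in S,
  [&& x != y, x != z, y != z, cmp x y & cmp x z]]]].

(** Either x, y, z are pairwise incomparable, or y witnesses that comparability
    is not transitive; both are absent exactly from unions of at most two
    unrelated chains. *)
Definition not_two_chains S := [exists x in S, [exists y in S, [exists z in S,
  ~~ cmp x z && (cmp x y == cmp y z)]]].
End Invariants.

Lemma nonextremal_inv f : embedding_invariant (fun d T => @nonextremal d T f).
Proof.
move=> d d' T T' h m A; have ih := mono_inj m.
rewrite /nonextremal big_imset /=; last by move=> ? ? _ _; apply: ih.
apply: eq_bigr => x _; rewrite exists_imset; congr nat_of_bool.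
by apply: eq_exists_in => y; rewrite mono_dlt.
Qed.

Lemma below_incomparable_inv : embedding_invariant
  (fun d T => @below_incomparable d T).
Proof.
move=> d d' T T' h m A; have ih := mono_inj m.
rewrite /below_incomparable big_imset /=; last by move=> ? ? _ _; apply: ih.
apply: eq_bigr => x _; rewrite exists_imset; congr nat_of_bool.
apply: eq_exists_in => y; rewrite exists_imset.
by apply: eq_exists_in => z; rewrite mono_cmp // m.
Qed.

Lemma cmp_pairs_inv : embedding_invariant (fun d T S => @cmp_pairs d T S S).
Proof.
move=> d d' T T' h m A; have ih := mono_inj m.
rewrite /cmp_pairs big_imset /=; last by move=> ? ? _ _; apply: ih.
apply: eq_bigr => x _; rewrite big_imset /=; last by move=> ? ? _ _; apply: ih.
by apply: eq_bigr => y _; rewrite mono_cmp.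
Qed.

Lemma branching_inv : embedding_invariant (fun d T => @branching d T).
Proof.
move=> d d' T T' h m A; have ih := mono_inj m.
rewrite /branching exists_imset; apply: eq_exists_in => x.
rewrite exists_imset; apply: eq_exists_in => y.
rewrite exists_imset; apply: eq_exists_in => z.
by rewrite !(inj_eq ih) !mono_cmp.
Qed.

Lemma not_two_chains_inv : embedding_invariant (fun d T => @not_two_chains d T).
Proof.
move=> d d' T T' h m A; have ih := mono_inj m.
rewrite /not_two_chains exists_imset; apply: eq_exists_in => x.
rewrite exists_imset; apply: eq_exists_in => y.
rewrite exists_imset; apply: eq_exists_in => z.
by rewrite !mono_cmp.
Qed.

Definition realized (W : Type)
    (phi : forall (d : Order.disp_t) (T : finPOrderType d), {set T} -> W)
    (P : poset_property) (n : nat) (w : W) :=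
  exists (d : Order.disp_t) (T : finPOrderType d) (A : {set T}),
    [/\ P d T, #|A| = n & phi d T A = w].

Lemma card_subposet (d : Order.disp_t) (T : finPOrderType d) (A : {set T}) :
  #|{: subposet A}| = #|A|.
Proof. exact: card_sig. Qed.

(** A class in iso_classes P n determines the value of the invariant on the
    posets it contains, so distinct realized values come from distinct
    classes. *)
Lemma speed_ge (W : eqType) phi P n (s : seq W) :
  embedding_invariant phi -> hereditary P -> uniq s ->
  {in s, forall w, realized phi P n w} -> size s <= speed P n.
Proof.
case: s => [//|w0 s'] iphi hP; set s := w0 :: s' => us hs.
(* A class is attached to the i-th value when all its members take this
   value. *)
pose R (i : 'I_(size s)) C := C \in iso_classes P n /\
  forall d (T : finPOrderType d), #|T| = n -> iso_class n T = C ->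
    phi d T [set: T] = nth w0 s i.
have [|F hF] := @choice _ _ R.
  move=> i; have [d [T [A [PT cA eA]]]] := hs _ (mem_nth w0 (ltn_ord i)).
  exists (iso_class n (subposet A)); split.
    rewrite inE; apply/asboolP; exists d, (subposet A); split => //.
      exact: hereditary_sub.
    by rewrite card_subposet.
  move=> d' T' cT' /(iso_class_eqP _ cT')[f [g fK gK] fm].
  rewrite -eA -(iphi _ _ _ _ _ fm).
  have -> : f @: [set: T'] = [set: subposet A].
    by apply/setP=> y; rewrite !inE; apply/imsetP; exists (g y);
      rewrite ?gK ?inE.
  rewrite -(iphi _ _ _ _ (val : subposet A -> T)) //; congr phi.
  apply/setP=> x; apply/imsetP/idP => [[u _ ->]|xA]; first exact: valP.
  by exists (Sub x xA).
have injF : injective F.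
  move=> i j e; have [ci hi] := hF i; have [_ hj] := hF j.
  move: ci; rewrite inE => /asboolP[d [T [PT cT eC]]].
  have := hi _ T cT (esym eC); rewrite (hj _ T cT) -?e -?eC // => /eqP.
  by rewrite (nth_uniq w0) // => /eqP/val_inj.
rewrite -[size s]card_ord -(card_imset _ injF).
by apply/subset_leq_card/subsetP=> C /imsetP[i _ ->]; have [] := hF i.
Qed.

Lemma speed_ge_nat phi P n m (w : nat -> nat) :
  embedding_invariant phi -> hereditary P -> {in gtn m &, injective w} ->
  (forall k, k < m -> realized phi P n (w k)) -> m <= speed P n.
Proof.
move=> iphi hP iw hw; rewrite -[m](size_iota 0) -(size_map w).
apply: (speed_ge iphi) => // [|_ /mapP[k + ->]]; last first.
  by rewrite mem_iota => /hw.
rewrite map_inj_in_uniq ?iota_uniq // => x y; rewrite !mem_iota !add0n.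
exact: iw.
Qed.

Definition with_pairs
    (flag : forall (d : Order.disp_t) (T : finPOrderType d), {set T} -> bool)
    (d : Order.disp_t) (T : finPOrderType d) (S : {set T}) :=
  (flag d T S, cmp_pairs S S).

(** The classes of a half family and those of its extensions are told apart by
    the flag, and within each group by the number of comparable pairs. *)
Lemma speed_ge_two (flag : forall (d : Order.disp_t) (T : finPOrderType d),
  {set T} ->
    bool)
    P n p q (v w : nat -> nat) :
  embedding_invariant flag -> hereditary P ->
  {in gtn p &, injective v} -> {in gtn q &, injective w} ->
  (forall k, k < p ->
    realized (with_pairs flag) P n (false, v k)) ->
  (forall k, k < q ->
    realized (with_pairs flag) P n (true, w k)) ->
  p + q <= speed P n.
Proof.
move=> iflag hP iv iw hv hw.
pose s := [seq (false, v k) | k <- iota 0 p] ++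
  [seq (true, w k) | k <- iota 0 q].
have -> : p + q = size s by rewrite size_cat !size_map !size_iota.
apply: (@speed_ge _ (with_pairs flag)) => //.
- by move=> d d' T T' h m A; rewrite /with_pairs iflag // (cmp_pairs_inv m).
- rewrite cat_uniq !map_inj_in_uniq ?iota_uniq /= ?andbT.
  + by apply/hasPn=> _ /mapP[k _ ->]; apply/negP=> /mapP[].
  + by move=> x y; rewrite !mem_iota !add0n => hx hy [] /iw; apply.
  + by move=> x y; rewrite !mem_iota !add0n => hx hy [] /iv; apply.
- move=> c; rewrite mem_cat => /orP[] /mapP[k + ->]; rewrite mem_iota.
  + exact: hv.
  + exact: hw.
Qed.

(** * Configurations with n subposets of size n *)

Section Pairs.
Context {d : Order.disp_t} {T : finPOrderType d}.
Implicit Types (x y z : T) (A B C S X : {set T}) (f : bool).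

Lemma cmp_pairs_sym A B : cmp_pairs A B = cmp_pairs B A.
Proof.
rewrite /cmp_pairs exchange_big /=; apply: eq_bigr => x _.
by apply: eq_bigr => y _; rewrite cmp_sym.
Qed.

Lemma cmp_pairsUr A B C : [disjoint B & C] ->
  cmp_pairs A (B :|: C) = cmp_pairs A B + cmp_pairs A C.
Proof.
move=> dBC; rewrite /cmp_pairs -big_split /=; apply: eq_bigr => x _.
by rewrite -bigU //; apply: eq_bigl => y; rewrite !inE.
Qed.

Lemma cmp_pairsU A B : [disjoint A & B] ->
  cmp_pairs (A :|: B) (A :|: B) =
  cmp_pairs A A + cmp_pairs B B + 2 * cmp_pairs A B.
Proof.
move=> dAB; rewrite cmp_pairsUr // ![cmp_pairs (_ :|: _) _]cmp_pairs_sym.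
by rewrite !cmp_pairsUr // (cmp_pairs_sym B A); lia.
Qed.

Lemma cmp_pairs_full A B : {in A & B, forall x y, cmp x y} ->
  cmp_pairs A B = #|A| * #|B|.
Proof.
move=> h; rewrite /cmp_pairs -sum_nat_const; apply: eq_bigr => x xA.
by rewrite -sum1_card; apply: eq_bigr => y yB; rewrite h.
Qed.

Lemma cmp_pairs_unrelated A B : unrelated A B -> cmp_pairs A B = 0.
Proof.
move=> h; rewrite /cmp_pairs big1 // => x xA.
by rewrite big1 // => y yB; rewrite (negPf (h _ _ xA yB)).
Qed.

Lemma cmp_pairs_match A B (p : T -> T) : {in A, forall x, p x \in B} ->
  {in A & B, forall x y, cmp x y = (y == p x)} -> cmp_pairs A B = #|A|.
Proof.
move=> hp h; rewrite /cmp_pairs -sum1_card; apply: eq_bigr => x xA.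
rewrite (bigD1 (p x)) ?hp //= h ?hp // eqxx big1 // => y /andP[yB n].
by rewrite h // (negPf n).
Qed.

Lemma cmp_pairs_antichain A : antichain A -> cmp_pairs A A = #|A|.
Proof.
move=> aA; apply: (@cmp_pairs_match _ _ id) => // x y xA yA.
by apply/idP/eqP => [/(aA _ _ xA yA)->//|->]; rewrite comparablexx.
Qed.

Lemma cmp_pairs_chain C : chain C -> cmp_pairs C C = #|C| * #|C|.
Proof. by move=> cC; apply: cmp_pairs_full. Qed.

Lemma cmp_pairs1 x : cmp_pairs [set x] [set x] = 1.
Proof. by rewrite /cmp_pairs !big_set1 comparablexx. Qed.

Lemma sum_pred_card S S' (p : pred T) : S' \subset S ->
  {in S, forall x, p x = (x \in S')} -> \sum_(x in S) p x = #|S'|.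
Proof.
move=> sS h; rewrite -sum1_card big_mkcond [RHS]big_mkcond; apply: eq_bigr
  => x _.
case: ifPn => [xS|/negP xS]; first by rewrite h //; case: (x \in S').
by case: ifPn => // /(subsetP sS).
Qed.

Lemma disjoint_dlt f A B : {in A & B, forall x y, dlt f x y} ->
  [disjoint A & B].
Proof.
move=> h; rewrite disjoints_subset; apply/subsetP=> x xA; rewrite inE.
by apply/negP=> xB; have := h _ _ xA xB; rewrite dltxx.
Qed.

End Pairs.

Lemma card_disjointU (T : finType) (A B : {set T}) : [disjoint A & B] ->
  #|A :|: B| = #|A| + #|B|.
Proof. by move=> dAB; apply/eqP; rewrite (leq_card_setU A B). Qed.

Section Forcing.
Variables (P : poset_property) (hP : hereditary P).
Variables (d : Order.disp_t) (T : finPOrderType d) (PT : P T).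
Implicit Types (x y z : T) (A B C S X : {set T}) (f : bool).
Variable n : nat.

(** With k points of B and n - k > 0 points of A, exactly the chosen points of B
    have something on the A side, because A is an antichain: k is recovered as
    their number, whatever the order on B. *)
Lemma speed_dominated f A B : antichain A -> n <= #|A| -> n <= #|B| ->
  {in A & B, forall x y, dlt f x y} -> n <= speed P n.
Proof.
move=> aA nA nB h; apply: (speed_ge_nat (w := id) (@nonextremal_inv (~~ f)))
  => // k kn.
have [B' sB cB] := @subset_of_card _ B k ltac:(lia).
have [A' sA cA] := @subset_of_card _ A (n - k) ltac:(lia).
have h' : {in A' & B', forall x y, dlt f x y}.
  by move=> x y /(subsetP sA) xA /(subsetP sB) yB; apply: h.
have /card_gt0P[a aA'] : 0 < #|A'| by lia.
exists d, T, (A' :|: B'); split => //.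
  by rewrite card_disjointU ?(disjoint_dlt h') //; lia.
rewrite /nonextremal -[RHS]cB; apply: sum_pred_card => [|x];
  first exact: subsetUr.
rewrite inE => xAB; apply/existsP/idP => [[y /andP[]]|xB]; last first.
  by exists a; rewrite dltN h' // inE aA'.
rewrite dltN inE => /orP[yA|yB] lyx; last by case/orP: xAB => // xA;
  have := h' _ _ xA yB; rewrite (dlt_asym lyx).
case/orP: xAB => // xA.
by rewrite (antichain_dlt f (antichainS sA aA) yA xA) in lyx.
Qed.

Lemma speed_antichain_chain A C : antichain A -> chain C -> unrelated A C ->
  n <= #|A| -> n <= #|C| -> n <= speed P n.
Proof.
move=> aA cC u nA nC.
apply: (speed_ge_nat (w := fun k => n - k.+1 + k.+1 * k.+1) cmp_pairs_inv)
  => // [|k kn].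
  by move=> k l; rewrite !inE => hk hl; nia.
have [A' sA cA] := @subset_of_card _ A (n - k.+1) ltac:(lia).
have [C' sC cC'] := @subset_of_card _ C k.+1 ltac:(lia).
have u' := unrelatedS sA sC u; have dj := unrelated_disjoint u'.
exists d, T, (A' :|: C'); split => //; first by rewrite card_disjointU //; lia.
rewrite cmp_pairsU // (cmp_pairs_unrelated u') (cmp_pairs_chain (chainS sC cC)).
by rewrite (cmp_pairs_antichain (antichainS sA aA)); lia.
Qed.

(** Stars: z, k points of A on one side of it, and n - k - 1 isolated points. *)
Lemma speed_antichain_split f z A : antichain A ->
  n <= #|[set a in A | dlt f a z]| -> n <= #|[set a in A | ~~ cmp a z]| ->
  n <= speed P n.
Proof.
move=> aA nD nI; apply: (speed_ge_nat (w := id) (@nonextremal_inv f))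
  => // k kn.
have [D sD cD] := @subset_of_card _ [set a in A | dlt f a z] k ltac:(lia).
have [I sI cI] := @subset_of_card _ [set a in A | ~~ cmp a z] (n - k.+1)
  ltac:(lia).
have hD x : x \in D -> x \in A /\ dlt f x z.
  by move=> /(subsetP sD); rewrite inE => /andP[].
have hI x : x \in I -> x \in A /\ ~~ cmp x z.
  by move=> /(subsetP sI); rewrite inE => /andP[].
have dDI : [disjoint D & I].
  rewrite disjoints_subset; apply/subsetP=> x /hD[_ /dlt_cmp xz]; rewrite inE.
  by apply/negP=> /hI[_]; rewrite xz.
have zDI : z \notin D :|: I.
  by rewrite inE; apply/negP=> /orP[/hD[_]|/hI[_]];
    rewrite ?dltxx ?comparablexx.
exists d, T, (z |: (D :|: I)); split => //.
  by rewrite cardsU1 zDI card_disjointU //; lia.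
rewrite /nonextremal -[RHS]cD; apply: sum_pred_card => [|x xS].
  by rewrite subsetU // subsetUl orbT.
have aS : {in D :|: I, forall y, y \in A}.
  by move=> y; rewrite inE => /orP[/hD[]|/hI[]].
apply/existsP/idP => [[y /andP[]]|xD]; last first.
  by exists z; rewrite !inE eqxx; have [_] := hD _ xD.
move: xS; rewrite in_setU1 => /orP[/eqP->|xS]; rewrite in_setU1
  => /orP[/eqP->|yS] h.
- by rewrite dltxx in h.
- move: yS; rewrite inE => /orP[/hD[_ h']|/hI[_ h']].
    by rewrite (dlt_asym h') in h.
  by rewrite (dlt_cmpr h) in h'.
- move: xS; rewrite inE => /orP[//|/hI[_ h']].
  by rewrite (dlt_cmp h) in h'.
- by rewrite (antichain_dlt f aA) ?aS in h.
Qed.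

(** A chain of n - 1 points and z, incomparable to k of them: the number of
    comparable pairs determines k. *)
Lemma speed_chain_split f z C : chain C ->
  n <= #|[set c in C | dlt f c z]| -> n <= #|[set c in C | ~~ cmp c z]| ->
  n <= speed P n.
Proof.
move=> cC nD nI.
apply: (speed_ge_nat (w := fun k => 1 + n.-1 * n.-1 + 2 * (n.-1 - k))
  cmp_pairs_inv) => // [|k kn].
  by move=> k l; rewrite !inE => hk hl; lia.
have [D sD cD] := @subset_of_card _ [set a in C | dlt f a z] (n.-1 - k)
  ltac:(lia).
have [I sI cI] := @subset_of_card _ [set a in C | ~~ cmp a z] k ltac:(lia).
have hD x : x \in D -> x \in C /\ dlt f x z.
  by move=> /(subsetP sD); rewrite inE => /andP[].
have hI x : x \in I -> x \in C /\ ~~ cmp x z.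
  by move=> /(subsetP sI); rewrite inE => /andP[].
have dDI : [disjoint D & I].
  rewrite disjoints_subset; apply/subsetP=> x /hD[_ /dlt_cmp xz]; rewrite inE.
  by apply/negP=> /hI[_]; rewrite xz.
have zDI : [disjoint [set z] & D :|: I].
  rewrite disjoints1 inE.
  by apply/negP=> /orP[/hD[_]|/hI[_]]; rewrite ?dltxx ?comparablexx.
have cS : #|D :|: I| = n.-1 by rewrite card_disjointU //; lia.
exists d, T, ([set z] :|: (D :|: I)); split => //.
  by rewrite card_disjointU // cS cards1; lia.
rewrite cmp_pairsU // cmp_pairs1 cmp_pairs_chain; last first.
  by apply: chainS cC; apply/subsetP=> x; rewrite inE => /orP[/hD[]|/hI[]].
rewrite cS cmp_pairsUr // cmp_pairs_full; last first.
  by move=> x y /set1P-> /hD[_ /dlt_cmpr].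
rewrite cmp_pairs_unrelated; last first.
  by move=> x y /set1P-> /hI[_]; rewrite cmp_sym.
by rewrite cards1; lia.
Qed.

(** The n - 1 ways of placing the incomparable pair c, z inside a chain of n - 2
    points, and the n-element chain. *)
Lemma speed_chain_twin c z C : chain C -> c \in C -> ~~ cmp c z ->
  n <= #|[set x in C | dlt true x z]| -> n <= #|[set x in C | dlt true z x]| ->
  n <= speed P n.
Proof.
move=> cC cC' cz nD nU.
(* Index 0 is the n-element chain; index k > 0 has k - 1 points below the
   pair. *)
apply: (speed_ge_nat (w := fun k => if k is 0 then 0 else k.+1)
  below_incomparable_inv) => // [|[_|k kn]].
- by case=> [|k] [|l]; rewrite !inE => hk hl; lia.
- have [D sD cD] := @subset_of_card _ _ _ nD.
  have cD' : chain D.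
    by apply: chainS cC; apply: subset_trans sD _; apply/subsetP=> x;
      rewrite inE => /andP[].
  exists d, T, D; split => //.
  rewrite /below_incomparable big1 // => x xD; case: existsP
    => //= -[y /andP[yD /existsP[z' /and3P[zD]]]].
  by rewrite cD'.
have [D sD cD] := @subset_of_card _ [set x in C | dlt true x z] k ltac:(lia).
have [U sU cU] := @subset_of_card _ [set x in C | dlt true z x] (n - k.+2)
  ltac:(lia).
have hD x : x \in D -> [/\ x \in C, (x < z)%O & (x < c)%O].
  move=> /(subsetP sD); rewrite inE /= => /andP[xC xz]; split=> //.
  have := cC _ _ xC cC'; rewrite (cmp_dlt true) /=
    => /or3P[/eqP e|//|/lt_trans /(_ xz)].
  - by move: cz; rewrite -e le_comparable // ltW.
  - by move/ltW/le_comparable; rewrite (negPf cz).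
have hU x : x \in U -> [/\ x \in C, (z < x)%O & (c < x)%O].
  move=> /(subsetP sU); rewrite inE /= => /andP[xC xz]; split=> //.
  have := cC _ _ xC cC'; rewrite (cmp_dlt true) /=
    => /or3P[/eqP e|/(lt_trans xz)|//].
  - by move: cz; rewrite cmp_sym -e le_comparable // ltW.
  - by move/ltW/le_comparable; rewrite cmp_sym (negPf cz).
have ncz : z != c by apply: contra cz => /eqP->; exact: comparablexx.
pose Q := [set z; c].
have cQ : #|Q| = 2 by rewrite cards2 ncz.
have dDQ : [disjoint D & Q].
  rewrite disjoints_subset; apply/subsetP=> x /hD[_ xz xc].
  by rewrite !inE !lt_eqF.
have dDQU : [disjoint D :|: Q & U].
  rewrite disjoint_sym disjoints_subset; apply/subsetP=> x /hU[_ xz xc].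
  rewrite !inE !gt_eqF // !orbF; apply/negP=> /hD[_ xz' _].
  by have := lt_trans xz xz'; rewrite ltxx.
exists d, T, (D :|: Q :|: U); split => //.
  by rewrite (card_disjointU dDQU) (card_disjointU dDQ); lia.
rewrite /below_incomparable (_ : k.+2 = #|D :|: Q|);
  last by rewrite (card_disjointU dDQ); lia.
apply: sum_pred_card => [|x xS]; first exact: subsetUl.
apply/existsP/idP => [[y /andP[yS /existsP[t /and3P[tS yt xy]]]]|xDQ].
  apply/negPn/negP=> xDQ; have xU : x \in U by move: xS;
    rewrite inE (negPf xDQ).
  have yC s : s \in D :|: Q :|: U -> (s \in C /\ (cmp s c)) \/ s = z.
    rewrite !inE -orbA => /or3P[/hD[sC _ _]||/hU[sC _ _]].
    - by left; rewrite cC.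
    - by case/orP=> /eqP ->; [right | left; rewrite comparablexx].
    - by left; rewrite cC.
  have [xC zx cx] := hU _ xU.
  have cmpz s : s \in D :|: Q :|: U -> s != c -> cmp s z.
    rewrite !inE -orbA => /or3P[/hD[_ sz _] _||/hU[_ sz _] _].
    - by rewrite le_comparable // ltW.
    - by case/orP=> /eqP -> //; rewrite ?eqxx // comparablexx.
    - by rewrite cmp_sym le_comparable // ltW.
  have zy := lt_le_trans zx xy; have cy := lt_le_trans cx xy.
  case: (yC _ yS) => [[yC' _]|e]; last by rewrite e ltxx in zy.
  case: (yC _ tS) => [[tC _]|e]; first by rewrite cC in yt.
  by rewrite e cmp_sym (le_comparable (ltW zy)) in yt.
have zS : z \in D :|: Q :|: U by rewrite !inE eqxx !orbT.
have cS : c \in D :|: Q :|: U by rewrite !inE eqxx !orbT.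
have [xz|xc] : (x <= z)%O \/ (x <= c)%O.
  move: xDQ; rewrite !inE => /or3P[/hD[_ /ltW]|/eqP->|/eqP->]; first by left.
  - by left.
  - by right.
- by exists z; rewrite zS; apply/existsP; exists c; rewrite cS cmp_sym cz.
- by exists c; rewrite cS; apply/existsP; exists z; rewrite zS cz.
Qed.

End Forcing.

(** * Matchings, unrelated chains, and their extensions *)

Section HalfFamilies.
Context {d : Order.disp_t} {T : finPOrderType d}.
Implicit Types (x y z : T) (A B C S : {set T}) (f : bool).

(** The pairs (q i, p i) carry the only comparabilities among these points;
    since the direction inside a pair is irrelevant to the isomorphism type,
    only comparability is recorded, and q and p play symmetric roles. *)
Definition matching (J : finType) (X : {set J}) (q p : J -> T) :=
  {in X &, forall i j, [/\ cmp (q i) (q j) = (i == j),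
    cmp (p i) (p j) = (i == j), cmp (q i) (p j) = (i == j) & q i != p j]}.

Lemma matchingS (J : finType) (X Y : {set J}) q p : Y \subset X ->
  matching X q p -> matching Y q p.
Proof. by move=> /subsetP s m i j /s hi /s hj; apply: m. Qed.

Lemma matching_sym (J : finType) (X : {set J}) q p :
  matching X q p -> matching X p q.
Proof.
move=> m i j iX jX; have [h1 h2 h3 h4] := m _ _ iX jX.
have [_ _ h5 h6] := m _ _ jX iX; split => //.
  by rewrite cmp_sym h5 eq_sym.
by rewrite eq_sym.
Qed.

Lemma branchingS S S' : S \subset S' -> branching S -> branching S'.
Proof.
move=> /subsetP s
  /existsP[x /andP[xS /existsP[y /andP[yS /existsP[z /andP[zS h]]]]]].
apply/existsP; exists x; rewrite s //; apply/existsP; exists y; rewrite s //.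
by apply/existsP; exists z; rewrite s.
Qed.

Lemma branchingP x y z S : x \in S -> y \in S -> z \in S -> x != y -> x != z ->
  y != z -> cmp x y -> cmp x z -> branching S.
Proof.
move=> xS yS zS h1 h2 h3 h4 h5.
apply/existsP; exists x; rewrite xS; apply/existsP; exists y; rewrite yS.
by apply/existsP; exists z; rewrite zS h1 h2 h3 h4 h5.
Qed.

Lemma not_two_chainsP x y z S : x \in S -> y \in S -> z \in S -> ~~ cmp x z ->
  cmp x y = cmp y z -> not_two_chains S.
Proof.
move=> xS yS zS h1 h2.
apply/existsP; exists x; rewrite xS; apply/existsP; exists y; rewrite yS.
by apply/existsP; exists z; rewrite zS h1 h2 eqxx.
Qed.

(** The k * C_2 + l * 1 subposets of a matching. The last clause provides a
    comparable pair, which together with a point above or below everything makes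
    a branching. *)
Lemma matching_sub (J : finType) (X : {set J}) q p k l : matching X q p ->
  k + l <= #|X| -> exists S, [/\ S \subset q @: X :|: p @: X, #|S| = 2 * k + l,
    cmp_pairs S S = 2 * k + l + 2 * k, ~~ branching S &
    0 < k -> exists x y, [/\ x \in S, y \in S, x != y & cmp x y]].
Proof.
move=> m hX; have [X1 [X2 [s1 s2 dX c1 c2]]] := subset_of_card2 hX.
have sX i : i \in X1 :|: X2 -> i \in X.
  by rewrite inE => /orP[/(subsetP s1)|/(subsetP s2)].
have s1X i : i \in X1 -> i \in X1 :|: X2 by rewrite inE => ->.
have qi : {in X1 :|: X2 &, injective q}.
  move=> i j /sX iX /sX jX e; have [h _ _ _] := m _ _ iX jX.
  by apply/eqP; rewrite -h e comparablexx.
have pi : {in X1 &, injective p}.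
  move=> i j /s1X/sX iX /s1X/sX jX e; have [_ h _ _] := m _ _ iX jX.
  by apply/eqP; rewrite -h e comparablexx.
pose A := q @: (X1 :|: X2); pose B := p @: X1.
have cA : #|A| = k + l by rewrite card_in_imset // card_disjointU // c1 c2.
have cB : #|B| = k by rewrite card_in_imset.
have dAB : [disjoint A & B].
  rewrite disjoints_subset; apply/subsetP=> _ /imsetP[i /sX iX ->]; rewrite inE.
  apply/negP=> /imsetP[j /s1X/sX jX]; have [_ _ _] := m _ _ iX jX.
  by move/eqP.
have aA : antichain A.
  move=> _ _ /imsetP[i /sX iX ->] /imsetP[j /sX jX ->].
  by have [-> _ _ _] := m _ _ iX jX => /eqP->.
have aB : antichain B.
  move=> _ _ /imsetP[i /s1X/sX iX ->] /imsetP[j /s1X/sX jX ->].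
  by have [_ -> _ _] := m _ _ iX jX => /eqP->.
have sAB : A :|: B \subset q @: X :|: p @: X.
  apply: setUSS; first by apply/imsetS/subsetP.
  by apply/imsetS.
exists (A :|: B); split => //.
- by rewrite card_disjointU // cA cB; lia.
- rewrite cmp_pairsU // !cmp_pairs_antichain // cA cB.
  rewrite (cmp_pairs_sym A); suff -> : cmp_pairs B A = k by lia.
  rewrite /cmp_pairs big_imset //= -c1 -sum1_card; apply: eq_bigr => i iX1.
  rewrite big_imset //= (bigD1 i) ?s1X //=.
  have [_ _ h _] := m _ _ (sX _ (s1X _ iX1)) (sX _ (s1X _ iX1)).
  rewrite cmp_sym h eqxx big1 // => j /andP[/sX jX ji].
  have [_ _ h' _] := m _ _ jX (sX _ (s1X _ iX1)).
  by rewrite cmp_sym h' (negPf ji).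
- have hidx u : u \in A :|: B -> exists2 i, i \in X & u = q i \/ u = p i.
    rewrite inE => /orP[/imsetP[i /sX iX ->]|/imsetP[i /s1X/sX iX ->]].
      by exists i => //; left.
    by exists i => //; right.
  have hij i j u v : i \in X -> j \in X -> u = q i \/ u = p i ->
      v = q j \/ v = p j -> cmp u v -> i = j.
    move=> iX jX; have [h1 h2 h3 _] := m _ _ iX jX; have [_ _ h3' _] :=
      m _ _ jX iX.
    move=> [] -> [] ->.
    + by rewrite h1 => /eqP.
    + by rewrite h3 => /eqP.
    + by rewrite cmp_sym h3' => /eqP.
    + by rewrite h2 => /eqP.
  apply/existsP => -[x /andP[/hidx[i iX xi] /existsP[y /andP[/hidx[j jX yj]]]]].
  case/existsP=> z /andP[/hidx[t tX zt] /and5P[n1 n2 n3 h1 h2]].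
  move: (hij _ _ _ _ iX jX xi yj h1) (hij _ _ _ _ iX tX xi zt h2) => e1 e2.
  move: n1 n2 n3; rewrite -{}e1 in yj; rewrite -{}e2 in zt.
  by move: xi yj zt => [] -> [] -> [] ->; rewrite ?eqxx.
- rewrite -c1 => /card_gt0P[i iX1]; have iX := sX _ (s1X _ iX1).
  have [_ _ h1 h2] := m _ _ iX iX; exists (q i), (p i).
  rewrite !inE !imset_f ?s1X // orbT; split => //.
  by rewrite h1 eqxx.
Qed.

Lemma two_chains_sub C1 C2 a b : chain C1 -> chain C2 -> unrelated C1 C2 ->
  a <= #|C1| -> b <= #|C2| -> exists A B : {set T},
    [/\ A \subset C1 /\ #|A| = a, B \subset C2 /\ #|B| = b, #|A :|: B| = a + b &
    cmp_pairs (A :|: B) (A :|: B) = a * a + b * b].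
Proof.
move=> cC1 cC2 u ha hb; have [A sA cA] := subset_of_card ha.
have [B sB cB] := subset_of_card hb.
have u' := unrelatedS sA sB u; have dj := unrelated_disjoint u'.
exists A, B; split => //; first by rewrite card_disjointU // cA cB.
rewrite cmp_pairsU // (cmp_pairs_unrelated u')
  (cmp_pairs_chain (chainS sA cC1)).
by rewrite (cmp_pairs_chain (chainS sB cC2)); lia.
Qed.

Lemma unrelated_chains_two A B : chain A -> chain B -> unrelated A B ->
  ~~ not_two_chains (A :|: B).
Proof.
move=> cA cB u; have e x y : x \in A :|: B -> y \in A :|: B ->
    cmp x y = ((x \in A) == (y \in A)).
  have dj z : z \in B -> (z \in A) = false.
    by move=> zB; apply: (disjointFl (unrelated_disjoint u) zB).
  rewrite !inE => /orP[hx|hx] /orP[hy|hy].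
  - by rewrite hx hy cA.
  - by rewrite hx (dj _ hy) (negPf (u _ _ hx hy)).
  - by rewrite hy (dj _ hx) cmp_sym (negPf (u _ _ hy hx)).
  - by rewrite !dj // cB.
apply/existsP => -[x /andP[xS /existsP[y /andP[yS /existsP[z /andP[zS]]]]]].
rewrite !e //.
by case: (x \in A); case: (y \in A); case: (z \in A).
Qed.

End HalfFamilies.

Section ForcingHalf.
Variables (P : poset_property) (hP : hereditary P) (n : nat).

Section OneStructure.
Variables (d : Order.disp_t) (T : finPOrderType d) (PT : P T).
Implicit Types (x y z : T) (A B C S : {set T}) (f : bool).

Lemma realized_matching (J : finType) (X : {set J}) (q p : J -> T) k :
  matching X q p -> n <= #|X| -> k <= n./2 ->
  realized (with_pairs (@branching)) P n
    (false, n + 2 * k).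
Proof.
move=> m nX kn; have [S [_ cS eS bS _]] := @matching_sub _ _ _ _ _ _ k
  (n - 2 * k) m ltac:(lia).
exists d, T, S; split => //; first by rewrite cS; lia.
by rewrite /with_pairs (negPf bS) eS; congr pair; lia.
Qed.

Lemma realized_two_chains C1 C2 k : chain C1 -> chain C2 -> unrelated C1 C2 ->
  n <= #|C1| -> n <= #|C2| -> k <= n./2 ->
  realized (with_pairs (@not_two_chains)) P n
    (false, k * k + (n - k) * (n - k)).
Proof.
move=> cC1 cC2 u n1 n2 kn.
have [A [B [[sA cA] [sB cB] cAB eAB]]] :=
  @two_chains_sub _ _ _ _ k (n - k) cC1 cC2 u ltac:(lia) ltac:(lia).
exists d, T, (A :|: B); split => //; first by rewrite cAB; lia.
rewrite /with_pairs eAB (negPf (unrelated_chains_two _ _ _)) //.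
- exact: chainS cC1.
- exact: chainS cC2.
- exact: unrelatedS u.
Qed.

Lemma speed_matching (J : finType) (X : {set J}) (q p : J -> T) :
  matching X q p -> n <= #|X| -> n./2.+1 <= speed P n.
Proof.
move=> m nX; rewrite -[n./2.+1]addn0.
apply: (@speed_ge_two _ _ _ _ _ (fun k => n + 2 * k) id branching_inv)
  => // k l.
  by rewrite !inE; lia.
exact: (realized_matching m nX).
Qed.

Lemma speed_two_chains C1 C2 : chain C1 -> chain C2 -> unrelated C1 C2 ->
  n <= #|C1| -> n <= #|C2| -> n./2.+1 <= speed P n.
Proof.
move=> cC1 cC2 u n1 n2; rewrite -[n./2.+1]addn0.
apply: (@speed_ge_two _ _ _ _ _ (fun k => k * k + (n - k) * (n - k)) id
  not_two_chains_inv) => // k l.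
  by rewrite !inE => hl hk; nia.
exact: (realized_two_chains cC1 cC2 u n1 n2).
Qed.

(** n = n./2.+1 + n.-1./2: it suffices to supply n.-1./2 classes that contain a
    branching. *)
Lemma speed_matching_extra (J : finType) (X : {set J}) (q p : J -> T)
  (w : nat -> nat) :
  0 < n -> matching X q p -> n <= #|X| ->
  {in gtn n.-1./2 &, injective w} ->
  (forall k, k < n.-1./2 ->
    realized (with_pairs (@branching)) P n (true, w k)) ->
  n <= speed P n.
Proof.
move=> n0 m nX iw hw; rewrite [leqLHS](_ : n = n./2.+1 + n.-1./2); last by lia.
apply: (@speed_ge_two _ _ _ _ _ (fun k => n + 2 * k) w branching_inv) => // k l.
  by rewrite !inE; lia.
exact: (realized_matching m nX).
Qed.

Lemma speed_two_chains_extra C1 C2 (w : nat -> nat) : 0 < n ->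
  chain C1 -> chain C2 -> unrelated C1 C2 -> n <= #|C1| -> n <= #|C2| ->
  {in gtn n.-1./2 &, injective w} ->
  (forall k, k < n.-1./2 ->
    realized (with_pairs (@not_two_chains)) P n (true, w k)) ->
  n <= speed P n.
Proof.
move=> n0 cC1 cC2 u n1 n2 iw hw.
rewrite [leqLHS](_ : n = n./2.+1 + n.-1./2); last by lia.
apply: (@speed_ge_two _ _ _ _ _ (fun k => k * k + (n - k) * (n - k)) w
  not_two_chains_inv) => // k l.
  by rewrite !inE => hl hk; nia.
exact: (realized_two_chains cC1 cC2 u n1 n2).
Qed.

(** A matching of n - 1 points with k + 1 >= 1 pairs, and z on one side of
    it. *)
Lemma speed_matching_cone f z (J : finType) (X : {set J}) (q p : J -> T) : 0 < n
  ->
  matching X q p -> n <= #|X| ->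
  {in X, forall i, dlt f (q i) z /\ dlt f (p i) z} -> n <= speed P n.
Proof.
move=> n0 m nX hz.
apply: (speed_matching_extra (w := fun k => n + 2 * n.-1 + 2 * k.+1) n0 m nX)
  => [|k kn].
  by move=> k l; rewrite !inE; lia.
have [S [sS cS eS _ hS]] :=
  @matching_sub _ _ _ _ _ _ k.+1 (n.-1 - 2 * k.+1) m ltac:(lia).
have {}hz x : x \in S -> dlt f x z.
  by move/(subsetP sS); rewrite inE => /orP[] /imsetP[i /hz[h1 h2] ->].
have {hS}[//|x [y [xS yS nxy cxy]]] := hS.
have zS : [disjoint [set z] & S].
  by rewrite disjoints1; apply/negP=> /hz; rewrite dltxx.
exists d, T, ([set z] :|: S); split => //.
  by rewrite card_disjointU // cards1 cS; lia.
rewrite /with_pairs; congr pair.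
  apply: (@branchingP _ _ x y z) => //; rewrite ?inE ?eqxx ?xS ?yS ?orbT //.
  - exact: dlt_neq (hz _ xS).
  - exact: dlt_neq (hz _ yS).
  - exact: dlt_cmp (hz _ xS).
rewrite cmp_pairsU // cmp_pairs1 eS cmp_pairs_full ?cards1 ?cS; last first.
  by move=> u v /set1P-> /hz/dlt_cmpr.
by lia.
Qed.

(** Q and a matching of n - 3 points: as Q is fixed, the number of comparable
    pairs determines the number of pairs of the matching. *)
Lemma speed_matching_branching (Q : {set T}) (J : finType) (X : {set J})
  (q p : J -> T) : 0 < n ->
  matching X q p -> n <= #|X| -> #|Q| = 3 -> branching Q ->
  unrelated Q (q @: X :|: p @: X) -> n <= speed P n.
Proof.
move=> n0 m nX cQ bQ uQ.
apply: (speed_matching_extra (w := fun k => cmp_pairs Q Q + n - 3 + 2 * k) n0 m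
  nX) => [|k kn].
  by move=> k l; rewrite !inE; lia.
have [S [sS cS eS _ _]] :=
  @matching_sub _ _ _ _ _ _ k (n - 3 - 2 * k) m ltac:(lia).
have u := unrelatedS (subxx Q) sS uQ; have dj := unrelated_disjoint u.
exists d, T, (Q :|: S); split => //.
  by rewrite card_disjointU // cQ cS; lia.
rewrite /with_pairs; congr pair; first by apply: branchingS bQ; exact: subsetUl.
by rewrite cmp_pairsU // (cmp_pairs_unrelated u) eS; lia.
Qed.

(** Two chains and an isolated point, or two chains and a point comparable to
    all: both cases give a point z with the same relation e to all the rest. *)
Lemma speed_two_chains_point (e : bool) z C1 C2 : 0 < n ->
  chain C1 -> chain C2 -> unrelated C1 C2 -> n <= #|C1| -> n <= #|C2| ->
  z \notin C1 :|: C2 -> {in C1 :|: C2, forall c, cmp c z = e} -> n <= speed P n.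
Proof.
move=> n0 cC1 cC2 u n1 n2 zC hz.
apply: (@speed_two_chains_extra _ _ (fun k => 1 + k.+1 * k.+1 +
  (n.-1 - k.+1) * (n.-1 - k.+1) + 2 * e * n.-1) n0 cC1 cC2 u n1 n2) => [|k kn].
  by move=> k l; rewrite !inE => hk hl; nia.
have [A [B [[sA cA] [sB cB] cAB eAB]]] :=
  @two_chains_sub _ _ _ _ k.+1 (n.-1 - k.+1) cC1 cC2 u ltac:(lia) ltac:(lia).
have sAB : A :|: B \subset C1 :|: C2 by exact: setUSS.
have dj : [disjoint [set z] & A :|: B].
  by rewrite disjoints1; apply: contra zC => /(subsetP sAB).
exists d, T, ([set z] :|: (A :|: B)); split => //.
  by rewrite card_disjointU // cards1 cAB; lia.
have /card_gt0P[x xA] : 0 < #|A| by lia.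
have /card_gt0P[y yB] : 0 < #|B| by lia.
rewrite /with_pairs; congr pair.
  apply: (@not_two_chainsP _ _ x z y); rewrite ?inE ?eqxx ?xA ?yB ?orbT //.
    by apply: u; [apply: (subsetP sA) | apply: (subsetP sB)].
  rewrite (cmp_sym z) !hz //; apply: (subsetP sAB).
    by rewrite inE yB orbT.
  by rewrite inE xA.
rewrite cmp_pairsU // cmp_pairs1 eAB.
have -> : cmp_pairs [set z] (A :|: B) = e * n.-1.
  have hz' : {in A :|: B, forall c, cmp z c = e}.
    by move=> c /(subsetP sAB) /hz; rewrite cmp_sym.
  case: (e) hz' => hz'; last first.
    by rewrite cmp_pairs_unrelated ?mul0n // => s c /set1P-> /hz' ->.
  rewrite cmp_pairs_full; first by rewrite cards1 cAB; lia.
  by move=> s c /set1P-> /hz' ->.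
by lia.
Qed.

(** The comparability graph consists of a clique in C2 and, apart from it, a
    clique in D all of whose points are joined to the non-adjacent points y and
    z. *)
Lemma speed_two_chains_twin y z (D : {set T}) C1 C2 : 0 < n ->
  chain C1 -> chain C2 -> unrelated C1 C2 -> n <= #|C1| -> n <= #|C2| ->
  D \subset C1 -> n <= #|D| ->
  {in D, forall c, cmp c y /\ cmp c z} -> ~~ cmp y z ->
  unrelated [set y; z] C2 -> n <= speed P n.
Proof.
move=> n0 cC1 cC2 u n1 n2 sD nD hD nyz uyz.
apply: (@speed_two_chains_extra _ _ (fun k => (n - k.+1) * (n - k.+1) - 2 +
  k.+1 * k.+1) n0 cC1 cC2 u n1 n2) => [|k kn].
  by move=> k l; rewrite !inE => hk hl; nia.
have uD := unrelatedS sD (subxx C2) u.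
have [A [B [[sA cA] [sB cB] cAB eAB]]] :=
  @two_chains_sub _ _ _ _ (n - 2 - k.+1) k.+1 (chainS sD cC1) cC2 uD ltac:(lia)
    ltac:(lia).
have {}hD c : c \in A -> cmp c y /\ cmp c z by move=> /(subsetP sA) /hD.
have {}uyz := unrelatedS (subxx _) sB uyz.
have dyz : [disjoint [set y] & [set z]].
  by rewrite disjoints1 inE; apply: contra nyz => /eqP->; exact: comparablexx.
have uy_z : unrelated [set y] [set z] by move=> s t /set1P-> /set1P->.
have dj : [disjoint [set y; z] & A :|: B].
  rewrite disjoints_subset; apply/subsetP=> x hx; rewrite !inE;
    apply/negP=> /orP[xA|xB].
    have [h1 h2] := hD _ xA; move: hx; rewrite !inE => /orP[]/eqP e; subst x.
      by rewrite h2 in nyz.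
    by rewrite cmp_sym h1 in nyz.
  by have := uyz _ _ hx xB; rewrite comparablexx.
exists d, T, ([set y; z] :|: (A :|: B)); split => //.
  by rewrite (card_disjointU dj) (card_disjointU dyz) !cards1 cAB; lia.
have /card_gt0P[x xB] : 0 < #|B| by lia.
have hy : y \in [set y; z] by rewrite !inE eqxx.
have hz : z \in [set y; z] by rewrite !inE eqxx orbT.
rewrite /with_pairs; congr pair.
  apply: (@not_two_chainsP _ _ y x z); rewrite ?inE ?eqxx ?xB ?orbT //.
  by rewrite cmp_sym (cmp_sym x z) (cmp_sym x) (negPf (uyz _ _ hy xB))
    (negPf (uyz _ _ hz xB)).
rewrite (cmp_pairsU dj) (cmp_pairsU dyz) !cmp_pairs1 eAB.
rewrite (cmp_pairs_unrelated uy_z) cmp_pairsUr; last first.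
  by apply: unrelated_disjoint (unrelatedS _ sB uD).
rewrite (cmp_pairs_unrelated uyz) cmp_pairs_full; last first.
  by move=> s t hs /hD[]; move: hs; rewrite !inE => /orP[]/eqP->;
    rewrite cmp_sym // => _ ;
   rewrite cmp_sym.
rewrite (card_disjointU dyz) !cards1 cA.
by nia.
Qed.

(** The comparability graph is that of two cliques, D with z and I with w,
    joined by the single edge from z to w. *)
Lemma speed_two_chains_zigzag w z (D I : {set T}) : 0 < n ->
  chain D -> chain I -> unrelated D I -> n <= #|D| -> n <= #|I| ->
  {in D, forall c, cmp c z /\ ~~ cmp c w} ->
    {in I, forall c, cmp c w /\ ~~ cmp c z} ->
  cmp z w -> n <= speed P n.
Proof.
move=> n0 cD cI u nD nI hD hI zw.
apply: (@speed_two_chains_extra _ _ (fun k => 2 + k.+1 * k.+1 +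
  (n - k.+1) * (n - k.+1)) n0 cD cI u nD nI) => [|k kn].
  by move=> k l; rewrite !inE => hk hl; nia.
have [A [B [[sA cA] [sB cB] _ _]]] :=
  @two_chains_sub _ _ _ _ (n - k.+2) k cD cI u ltac:(lia) ltac:(lia).
have {}hD c : c \in A -> cmp c z /\ ~~ cmp c w by move=> /(subsetP sA) /hD.
have {}hI c : c \in B -> cmp c w /\ ~~ cmp c z by move=> /(subsetP sB) /hI.
have /card_gt0P[x xA] : 0 < #|A| by lia.
have zw' : z != w.
  by have [h1] := hD _ xA; apply: contra => /eqP <-.
have {}u := unrelatedS sA sB u.
have zA : [disjoint [set z] & A].
  rewrite disjoints1; apply/negP=> h; have [_] := hD _ h; by rewrite zw.
have wB : [disjoint [set w] & B].
  rewrite disjoints1; apply/negP=> h; have [_] := hI _ h; by rewrite cmp_sym zw.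
have u1 : unrelated [set z] B by move=> s t /set1P-> /hI[_]; rewrite cmp_sym.
have u2 : unrelated A [set w] by move=> s t /hD[_ h] /set1P->.
have dj : [disjoint [set z] :|: A & [set w] :|: B].
  rewrite disjoints_subset; apply/subsetP=> s; rewrite !inE => /orP[/eqP->|sA'].
    rewrite (negPf zw') /=; apply/negP=> /hI[_]; by rewrite comparablexx.
  apply/negP=> /orP[/eqP e|sB'].
    by have [_] := hD _ sA'; rewrite e comparablexx.
  by have := u _ _ sA' sB'; rewrite comparablexx.
exists d, T, (([set z] :|: A) :|: ([set w] :|: B)); split => //.
  by rewrite (card_disjointU dj) !card_disjointU // !cards1; lia.
have [xz xw] := hD _ xA.
rewrite /with_pairs; congr pair.
  apply: (@not_two_chainsP _ _ x z w); rewrite ?inE ?eqxx ?xA ?orbT //.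
  by rewrite xz zw.
rewrite (cmp_pairsU dj).
have c1 : chain ([set z] :|: A).
  apply: chainU (chainS sA cD) _; first exact: chain1.
  by move=> s t /set1P-> /hD[+ _]; rewrite cmp_sym.
have c2 : chain ([set w] :|: B).
  apply: chainU (chainS sB cI) _; first exact: chain1.
  by move=> s t /set1P-> /hI[+ _]; rewrite cmp_sym.
rewrite (cmp_pairs_chain c1) (cmp_pairs_chain c2) (cmp_pairsUr _ wB).
rewrite ![cmp_pairs (_ :|: A) _]cmp_pairs_sym !(cmp_pairsUr _ zA).
rewrite (cmp_pairs_sym _ [set z]) (cmp_pairs_sym _ A) (cmp_pairs_sym _ [set z])
  (cmp_pairs_sym _ A).
rewrite (cmp_pairs_unrelated u) (cmp_pairs_unrelated u1)
  (cmp_pairs_unrelated u2).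
rewrite cmp_pairs_full; last by move=> s t /set1P-> /set1P->.
by rewrite !card_disjointU // !cards1 cA cB; nia.
Qed.

End OneStructure.

(** Of the two-chain posets only those whose longer chain has at least three
    elements are used, since these are not matchings. *)
Lemma speed_matching_and_chains (d d' : Order.disp_t) (T : finPOrderType d)
    (T' : finPOrderType d') (J : finType) (X : {set J}) (q p : J -> T)
    (C1 C2 : {set T'}) : 0 < n -> P T -> P T' ->
  matching X q p -> n <= #|X| ->
  chain C1 -> chain C2 -> unrelated C1 C2 -> n <= #|C1| -> n <= #|C2| ->
  n <= speed P n.
Proof.
move=> n0 PT PT' m nX cC1 cC2 u n1 n2.
apply: (speed_matching_extra (w := fun k => k * k + (n - k) * (n - k)) PT n0 m
  nX) => [|k kn].
  by move=> k l; rewrite !inE => hk hl; nia.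
have [A [B [[sA cA] [sB cB] cAB eAB]]] :=
  @two_chains_sub _ _ _ _ k (n - k) cC1 cC2 u ltac:(lia) ltac:(lia).
exists d', T', (A :|: B); split => //; first by rewrite cAB; lia.
rewrite /with_pairs eAB; congr pair.
apply: branchingS (subsetUr A B) _; have cB' := chainS sB cC2.
have /card_geqP[s [us ss sB']] : 3 <= #|B| by lia.
move: us ss sB'; case: s => [|x [|y [|z s]]] //= /and3P[].
rewrite !inE !negb_or => /and3P[xy xz _] /andP[yz _] _ _ sB'.
have h v : v \in [:: x, y, z & s] -> v \in B by apply: sB'.
by apply: (@branchingP _ _ x y z); rewrite ?cB' ?h ?inE ?eqxx ?orbT.
Qed.

End ForcingHalf.

(** * Modules, matchings and unrelated chains in a poset *)

(** Greedy choice in a bipartite graph of degrees at most D: after choosing an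
    edge (a, b), discard from B the neighbours of the neighbours of b, at most D
    * D elements. This keeps a and b away from the later pairs. *)
Lemma induced_matching (T : finType) (r : T -> T -> bool) D m (A B : {set T}) :
  {in B, forall b, exists2 a, a \in A & r a b} ->
  {in B, forall b, #|[set a in A | r a b]| <= D} ->
  {in A, forall a, #|[set b in B | r a b]| <= D} ->
  m * (D * D).+1 <= #|B| ->
  exists (Y : {set T}) (p : T -> T), [/\ Y \subset B, #|Y| = m,
    {in Y, forall x, p x \in A} & {in Y &, forall x y, r (p x) y = (x == y)}].
Proof.
elim: m B => [|m IH] B hB dB dA cB.
  by exists set0, id; rewrite sub0set cards0; split => // x; rewrite inE.
have /card_gt0P[b bB] : 0 < #|B| by lia.
have [a aA rab] := hB _ bB.
(* F contains b itself, since b has the neighbour a. *)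
pose F := \bigcup_(a' in [set a in A | r a b]) [set b' in B | r a' b'].
have inF a' b' : a' \in A -> r a' b -> b' \in B -> r a' b' -> b' \in F.
  by move=> h1 h2 h3 h4; apply/bigcupP; exists a'; rewrite inE ?h1 ?h3.
have cBF : m * (D * D).+1 <= #|B :\: F|.
  apply: (@avoid_nbrs _ _ _ _ _ D) => [a'|].
    by rewrite inE => /andP[/dA].
  have := dB _ bB; nia.
have sBF : B :\: F \subset B by exact: subsetDl.
have [||||Y [p [sY cY pA hY]]] := IH (B :\: F).
- by move=> b' /(subsetP sBF) /hB.
- by move=> b' /(subsetP sBF) /dB.
- move=> a' /dA; apply: leq_trans; apply/subset_leq_card/subsetP=> b'.
  by rewrite !inE -andbA => /and3P[_ -> ->].
- by [].
have YB y : y \in Y -> y \in B /\ y \notin F.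
  by move/(subsetP sY); rewrite inE => /andP[].
have bY : b \notin Y by apply/negP=> /YB[_]; rewrite (inF a).
exists (b |: Y), (fun x => if x == b then a else p x); split.
- by rewrite subUset sub1set bB (subset_trans sY).
- by rewrite cardsU1 bY cY.
- by move=> x; rewrite in_setU1; case: eqP => //= _ /pA.
move=> x y; rewrite !in_setU1.
case: (eqVneq x b) => [->|xb] /=; case: (eqVneq y b) => [->|yb] //=.
- move=> _ /YB[yB yF]; apply: contraNF yF => ray; exact: (inF a).
- move=> xY _; have [xB xF] := YB _ xY; rewrite (negPf xb); apply: contraNF xF
  => rxb.
  by apply: (inF (p x)) => //; rewrite ?pA ?hY ?eqxx.
- exact: hY.
Qed.

Section Structure.
Context {d : Order.disp_t} {T : finPOrderType d}.
Implicit Types (x y z : T) (A B C M S X : {set T}) (f : bool).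

(** The configurations which, in size K, force K isomorphism classes of
    K-element subposets. *)
Record no_linear_family (K : nat) : Prop := NoLinearFamily {
  no_dominated : forall f A B, antichain A -> K <= #|A| -> K <= #|B| ->
    ~ {in A & B, forall x y, dlt f x y};
  no_antichain_chain : forall A C, antichain A -> chain C ->
    K <= #|A| -> K <= #|C| -> ~ unrelated A C;
  no_antichain_split : forall f z A, antichain A ->
    K <= #|[set a in A | dlt f a z]| -> #|[set a in A | ~~ cmp a z]| < K;
  no_chain_split : forall f z C, chain C ->
    K <= #|[set c in C | dlt f c z]| -> #|[set c in C | ~~ cmp c z]| < K;
  no_chain_twin : forall c z C, chain C -> c \in C -> ~~ cmp c z ->
    K <= #|[set x in C | dlt true x z]| -> #|[set x in C | dlt true z x]| < K
}.

(** A chain (kind = true) or an antichain that is a module: no outside point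
    tells two of its elements apart. *)
Definition homogeneous (kind : bool) M :=
  (if kind then chain M else antichain M) /\
  forall x y z, x \notin M -> y \in M -> z \in M ->
    (x <= y)%O = (x <= z)%O /\ (y <= x)%O = (z <= x)%O.

Definition has_matching m := exists (X : {set T}) (q p : T -> T),
  matching X q p /\ m <= #|X|.

Definition has_two_chains m := exists C1 C2 : {set T},
  [/\ chain C1, chain C2, unrelated C1 C2, m <= #|C1| & m <= #|C2|].

Lemma exists_max (Q : {set T} -> Prop) A0 : Q A0 ->
  exists2 A, Q A & forall B, Q B -> #|B| <= #|A|.
Proof.
move=> Q0; have q0 : [pred A | `[< Q A >]] A0 by apply/asboolP.
case: (arg_maxnP (fun A : {set T} => #|A|) q0) => A /asboolP QA h.
by exists A => // B QB; apply: h; apply/asboolP.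
Qed.

Variables (K : nat) (K0 : 0 < K) (exc : no_linear_family K).

(** Once x is on one side of some element of A, it cannot be on the other side
    of any: A would contain a comparable pair. *)
Lemma antichain_dominatedE f A x : antichain A ->
  0 < #|[set a in A | dlt f a x]| ->
  {in A, forall a, dlt f a x = cmp a x}.
Proof.
move=> aA /card_gt0P[b]; rewrite inE => /andP[bA bx] a aA'.
apply/idP/idP => [/dlt_cmp//|]; rewrite (cmp_dlt f) => /or3P[/eqP e|//|h].
  by rewrite -e (antichain_dlt f aA) in bx.
by have := dlt_trans bx h; rewrite (antichain_dlt f aA).
Qed.

(** The points that are not incomparable to almost all of A; if A is an
    antichain, each of them is on one side of almost all of A. *)
Definition dominators A := [set x | (K <= #|[set a in A | dlt true a x]|) ||
  (K <= #|[set a in A | dlt false a x]|)].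

(** K dominators on the same side have K common points of A on the other side,
    since each misses fewer than K of them. *)
Lemma few_dominators f A : antichain A -> K * K + K <= #|A| ->
  #|[set x | K <= #|[set a in A | dlt f a x]|]| < K.
Proof.
move=> aA nA; rewrite ltnNge; apply/negP => h; have [B sB cB] := subset_of_card
  h.
have {}sB b : b \in B -> K <= #|[set a in A | dlt f a b]|.
  by move/(subsetP sB); rewrite inE.
pose F b := [set a in A | ~~ cmp a b].
have hF : {in B, forall b, #|F b| <= K}.
  by move=> b /sB h'; apply/ltnW/no_antichain_split/h'.
have hA : K <= #|A :\: \bigcup_(b in B) F b|.
  by apply: (@avoid_nbrs _ _ _ _ _ K) => //; rewrite cB.
apply: (no_dominated exc (f := f) (antichainS (subsetDl _ _) aA) hA (B := B)).
  by rewrite cB.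
move=> a b; rewrite inE => /andP[/bigcupP nF aA'] bB.
rewrite (antichain_dominatedE aA) //; last exact: leq_trans K0 (sB _ bB).
by apply/negPn/negP=> nc; apply: nF; exists b; rewrite ?inE ?aA'.
Qed.

Lemma card_dominators A : antichain A -> K * K + K <= #|A| ->
  #|dominators A| <= 2 * K.
Proof.
move=> aA nA; have -> : dominators A =
  [set x | K <= #|[set a in A | dlt true a x]|] :|:
  [set x | K <= #|[set a in A | dlt false a x]|].
  by apply/setP=> x; rewrite !inE.
apply: leq_trans (leq_cardsU _ _) _.
by have := few_dominators true aA nA; have := few_dominators false aA nA; lia.
Qed.

Lemma non_dominators A x : x \notin dominators A ->
  #|[set a in A | cmp a x]| <= 2 * K.
Proof.
rewrite inE negb_or -!ltnNge => /andP[h1 h2].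
have : [set a in A | cmp a x] \subset [set x] :|:
    ([set a in A | dlt true a x] :|: [set a in A | dlt false a x]).
  by apply/subsetP=> a; rewrite !inE (cmp_dlt true) /= => /andP[-> /or3P[] ->];
    rewrite ?orbT.
move/subset_leq_card/leq_trans; apply.
apply: leq_trans (leq_cardsU _ _) _; rewrite cards1.
have := leq_cardsU [set a in A | dlt true a x] [set a in A | dlt false a x];
  lia.
Qed.

(** A third of the chain avoids the dominators of A; K of these elements are
    unrelated to most of A. *)
Lemma no_long_antichain_and_chain A C : antichain A -> chain C ->
  2 * K * K + K <= #|A| -> 3 * K <= #|C| -> False.
Proof.
move=> aA cC nA nC; have hd := @card_dominators A aA ltac:(nia).
have [C' sC cC'] := @subset_of_card _ (C :\: dominators A) K
  ltac:(have := leq_cardsD C (dominators A); lia).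
have {}sC c : c \in C' -> c \in C /\ c \notin dominators A.
  by move/(subsetP sC); rewrite inE => /andP[].
have hA : K <= #|A :\: \bigcup_(c in C') [set a in A | cmp a c]|.
  apply: (@avoid_nbrs _ _ _ _ _ (2 * K)) => [c /sC[_ /non_dominators]//|].
  by rewrite cC'; nia.
apply: (no_antichain_chain exc (antichainS (subsetDl _ _) aA) (C := C') _ hA).
- by apply: chainS cC; apply/subsetP=> c /sC[].
- by rewrite cC'.
- move=> a c; rewrite inE => /andP[/bigcupP nF aA'] cC''; apply/negP => h.
  by apply: nF; exists c; rewrite ?inE ?aA'.
Qed.

Lemma antichain_almost_uniform A x : antichain A -> x \notin A ->
  exists E : {set T}, #|E| <= 2 * K /\ {in A :\: E &, forall y z,
    (x <= y)%O = (x <= z)%O /\ (y <= x)%O = (z <= x)%O}.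
Proof.
move=> aA xA.
have dom f : K <= #|[set a in A | dlt f a x]| ->
    exists E : {set T}, #|E| <= 2 * K /\ {in A :\: E, forall a, dlt f a x}.
  move=> h; exists [set a in A | ~~ cmp a x]; split.
    by have := no_antichain_split exc aA h; lia.
  move=> a; rewrite !inE => /andP[h1 h2]; rewrite (antichain_dominatedE aA) //.
    by move: h1; rewrite h2 /= negbK.
  exact: leq_trans K0 h.
have [/dom[E [cE hE]]|h1] := leqP K #|[set a in A | dlt true a x]|.
  by exists E; split => // y z /hE hy /hE hz;
    rewrite !(ltW hy, ltW hz, lt_geF hy, lt_geF hz).
have [/dom[E [cE hE]]|h2] := leqP K #|[set a in A | dlt false a x]|.
  by exists E; split => // y z /hE hy /hE hz;
    rewrite !(ltW hy, ltW hz, lt_geF hy, lt_geF hz).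
exists [set a in A | cmp a x]; split.
  by apply: non_dominators; rewrite inE; lia.
have h y : y \in A :\: [set a in A | cmp a x] -> (x <= y)%O = false /\
  (y <= x)%O = false.
  rewrite !inE => /andP[+ yA]; rewrite yA /= => nc; split.
    by apply: contraNF nc => h; rewrite cmp_sym le_comparable.
  by apply: contraNF nc => h; rewrite le_comparable.
by move=> y z yA zA; have [-> ->] := h _ yA; have [-> ->] := h _ zA.
Qed.

Definition antichain_module_bound h m := h * (2 * K * K + 3 * K) +
  h * (m * (2 * K * (2 * K)).+1 + K * K + 5 * K) * (2 * K).+1.

(** Case of bounded chains. Let A be a maximum antichain and B a large antichain
    in its complement. After removal of the dominators, the comparability graph
    between A and B has degrees at most 2 * K; by maximality of A few elements
    of B have no neighbour, whence an induced matching. If there is no such B,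
    Mirsky's theorem bounds the complement of A, and each point outside A spoils
    at most 2 * K elements of A. *)
Lemma antichain_module h m : (forall C, chain C -> #|C| <= h) ->
  (exists kind M, homogeneous kind M /\
     #|~: M| <= antichain_module_bound h m) \/
  has_matching m.
Proof.
rewrite /antichain_module_bound => hh; set s := m * (2 * K * (2 * K)).+1 + K * K
  + 5 * K.
have [A aA maxA] := @exists_max (fun A => antichain A) set0 ltac:(by move=> x y;
  rewrite inE).
have hX : forall (X : {set T}) w, (forall B, B \subset X -> antichain B ->
  #|B| <= w) -> #|X| <= h * w.
  move=> X w hw; have [[C [_ cC hC]]|//] := mirsky h hw.
  by have := hh _ cC; rewrite hC ltnn.
have [small|bigA] := ltnP #|A| (2 * K * K + 3 * K).
  left; exists true, set0; split; first by split => [x y|x y z _]; rewrite inE.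
  apply: leq_trans (leq_addr _ _); apply: hX => B _ aB.
  by apply/ltnW/(leq_ltn_trans (maxA _ aB)).
have [[B [sB aB cB]]|small] :=
  pselect (exists B, [/\ B \subset ~: A, antichain B & s < #|B|]).
  right.
  have dA := @card_dominators A aA ltac:(nia).
  have dB := @card_dominators B aB ltac:(lia).
  pose A1 := A :\: dominators B; pose B1 := B :\: dominators A.
  have hA1 : #|A| <= #|A1| + 2 * K.
    by apply: leq_trans (leq_cardsD A (dominators B)) _; rewrite leq_add2l.
  have hB1 : #|B| <= #|B1| + 2 * K.
    by apply: leq_trans (leq_cardsD B (dominators A)) _; rewrite leq_add2l.
  (* A1 with B0 is an antichain and A1 is almost all of A: B0 is small. *)
  pose B0 := [set b in B1 | [forall a in A1, ~~ cmp a b]].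
  have aA1 : antichain A1 by apply: antichainS aA; exact: subsetDl.
  have aB0 : antichain B0.
    by apply: antichainS aB; apply/subsetP=> b; rewrite !inE -!andbA
      => /and3P[_ ->].
  have u0 : unrelated A1 B0.
    by move=> a b ha; rewrite inE => /andP[_ /forall_inP]; apply.
  have hB0 : #|B0| <= 2 * K.
    have := maxA _ (antichainU aA1 aB0 u0).
    by rewrite card_disjointU ?unrelated_disjoint //; lia.
  pose B2 := B1 :\: B0.
  have hB2 : #|B1| <= #|B2| + 2 * K.
    by apply: leq_trans (leq_cardsD B1 B0) _; rewrite leq_add2l.
  have sB2 b : b \in B2 -> [/\ b \in B, b \notin dominators A & exists2 a,
    a \in A1 & cmp a b].
    move=> /setDP[bB1 nB0]; have /setDP[bB nd] := bB1; split => //.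
    move: nB0; rewrite inE bB1 negb_forall => /existsP[a].
    by rewrite negb_imply negbK => /andP[ha hab]; exists a.
  have [||||Y [p [sY cY pA hY]]] :=
    @induced_matching _ (fun a b : T => cmp a b) (2 * K) m A1 B2.
  - by move=> b /sB2[].
  - move=> b /sB2[_ /non_dominators + _]; apply: leq_trans.
    by apply/subset_leq_card/subsetP=> a; rewrite !inE => /andP[/andP[_ ->]].
  - move=> a; rewrite inE => /andP[/non_dominators + _]; apply: leq_trans.
    apply/subset_leq_card/subsetP=> b; rewrite inE => /andP[/sB2[bB _ _] hab].
    by rewrite inE bB cmp_sym.
  - by rewrite /s in cB; lia.
  have YB y : y \in Y -> y \in B by move/(subsetP sY)/sB2 => [].
  have pA' y : y \in Y -> p y \in A by move/pA; rewrite inE => /andP[].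
  exists Y, id, p; split; last by rewrite cY.
  move=> i j iY jY; split.
  - by apply/idP/eqP => [/aB->//|->]; rewrite ?YB // comparablexx.
  - apply/idP/idP => [h0|/eqP->]; last exact: comparablexx.
    by rewrite -hY // (aA _ _ (pA' _ iY) (pA' _ jY) h0) hY.
  - by rewrite cmp_sym hY // eq_sym.
  - apply/eqP=> /= e; have := subsetP sB _ (YB _ iY).
    by rewrite inE e pA'.
left.
have [x|E hE] := @choice _ _ (fun x (E : {set T}) => x \notin A ->
    #|E| <= 2 * K /\ {in A :\: E &, forall y z,
    (x <= y)%O = (x <= z)%O /\ (y <= x)%O = (z <= x)%O}).
  case: (boolP (x \in A)) => [xA|xA]; first by exists set0.
  by have [E hE] := antichain_almost_uniform aA xA; exists E.
pose M := A :\: \bigcup_(x in ~: A) E x.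
have cX : #|~: A| <= h * s.
  apply: hX => B sB aB; rewrite leqNgt; apply/negP=> h'.
  by apply: small; exists B.
exists false, M; split.
  split; first by apply: antichainS aA; exact: subsetDl.
  move=> x y z xM yM zM.
  have [xA|xA] := boolP (x \in A).
    have inc t : t \in M -> (x <= t)%O = false /\ (t <= x)%O = false.
      move=> tM; have tA : t \in A by move: tM; rewrite inE => /andP[].
      have nxt : x != t by apply: contraNneq xM => ->.
      split; apply: contraNF nxt => /le_comparable; first by move/aA->.
      by rewrite cmp_sym => /aA->.
    by have [-> ->] := inc _ yM; have [-> ->] := inc _ zM.
  have [_] := hE _ xA; apply.
  - move: yM; rewrite !inE => /andP[yU ->]; rewrite andbT.
    by apply: contra yU => yE; apply/bigcupP; exists x; rewrite ?inE.
  - move: zM; rewrite !inE => /andP[yU ->]; rewrite andbT.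
    by apply: contra yU => yE; apply/bigcupP; exists x; rewrite ?inE.
have := @avoid_nbrs _ _ A (~: A) E (2 * K) (#|A| - #|~: A| * (2 * K))
  ltac:(by move=> x; rewrite inE => /hE[]).
have := cardsC A; have := cardsC M; rewrite -/M.
have [le|gt] := leqP (#|~: A| * (2 * K)) #|A|.
  by move=> e1 e2 /(_ ltac:(lia)); nia.
by nia.
Qed.

(** A point x incomparable to some c in C is on one side of almost all of C as
    soon as it is on that side of K elements: no_chain_split bounds the elements
    incomparable to x and no_chain_twin those on the other side. *)
Lemma chain_types C x c : chain C -> c \in C -> ~~ cmp c x ->
  forall f, K <= #|[set y in C | dlt f y x]| ->
  #|[set y in C | ~~ dlt f y x]| < 2 * K.
Proof.
move=> cC cC' cx f h; have h1 := no_chain_split exc cC h.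
have h2 : #|[set y in C | dlt f x y]| < K.
  case: f h h1 => h _.
    exact: (no_chain_twin exc cC cC' cx).
  rewrite ltnNge; apply/negP=> h'.
  by have := no_chain_twin exc cC cC' cx h'; rewrite ltnNge h.
have hx : x \notin C by apply: contra cx => xC; exact: cC.
have : [set y in C | ~~ dlt f y x] \subset
    [set y in C | ~~ cmp y x] :|: [set y in C | dlt f x y].
  apply/subsetP=> y; rewrite !inE (cmp_dlt f) => /andP[yC /negPf->];
    rewrite yC /=.
  have -> : (y == x) = false by apply: contraNF hx => /eqP<-.
  by rewrite orNb.
move/subset_leq_card; have := leq_cardsU [set y in C | ~~ cmp y x]
  [set y in C | dlt f x y].
by lia.
Qed.

(** The relation of C to an outside point can only be irregular near the ends of
    C, which the core leaves out. *)
Definition chain_core C k :=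
  [set c in C | (k <= #|below true C c|) && (k <= #|below false C c|)].

Lemma card_chain_core C k : chain C -> #|C| <= #|chain_core C k| + 2 * k.
Proof.
move=> cC; have : C \subset chain_core C k :|:
  ([set x in C | #|below true C x| < k]
    :|: [set x in C | #|below false C x| < k]).
  by apply/subsetP=> x xC; rewrite !inE xC /=; do 2!case: leqP.
move/subset_leq_card/leq_trans; apply.
apply: leq_trans (leq_cardsU _ _) _; rewrite leq_add2l.
apply: leq_trans (leq_cardsU _ _) _.
by have := chain_low true k cC; have := chain_low false k cC; lia.
Qed.

Lemma chain_coreP f C k c : c \in chain_core C k ->
  c \in C /\ k <= #|below f C c|.
Proof. by rewrite inE => /and3P[h1 h2 h3]; case: f. Qed.

Definition chain_module_bound w m :=
  w * (3 * K + m) + w * (m + 4 * K) + 4 * K.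

(** Case of bounded antichains. Let C be a maximum chain and B a long chain in
    its complement. If many elements of B were on one side of most of C, then
    replacing a few elements of C by them would give a chain longer than C;
    hence most of B is unrelated to the core of C. If there is no such B,
    Mirsky's theorem bounds the complement of C, and the core of C is a
    module. *)
Lemma chain_module w m : (forall A, antichain A -> #|A| <= w) ->
  (exists kind M, homogeneous kind M /\
     #|~: M| <= chain_module_bound w m) \/
  has_two_chains m.
Proof.
rewrite /chain_module_bound => hw; set s := m + 4 * K.
have [C cC maxC] := @exists_max (fun C => chain C) set0 ltac:(by move=> x y;
  rewrite inE).
have hX (X : {set T}) k : (forall B, B \subset X -> chain B -> #|B| <= k) ->
  #|X| <= w * k.
  move=> hk; rewrite mulnC.
  have [B _ aB|[B [sB cB hB]]|//] := @mirsky _ _ X w k; first exact: hw.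
  by have := hk _ sB cB; rewrite hB ltnn.
have [small|bigC] := ltnP #|C| (3 * K + m).
  left; exists true, set0; split; first by split => [x y|x y z _]; rewrite inE.
  rewrite -addnA; apply: leq_trans (leq_addr _ _); apply: hX => B _ cB.
  by apply/ltnW/(leq_ltn_trans (maxC _ cB)).
have hinc x : x \notin C -> exists2 c, c \in C & ~~ cmp c x.
  move=> xC; apply/exists_inP; apply: contraT; rewrite negb_exists => /forallP
    h.
  have : chain ([set x] :|: C).
    apply: chainU => //; first exact: chain1.
    move=> y c /set1P-> cC'; have := h c; rewrite cC' negbK.
    by rewrite cmp_sym.
  by move/maxC; rewrite cardsU1 xC ltnn.
have types x f : x \notin C -> K <= #|[set y in C | dlt f y x]| ->
    #|[set y in C | ~~ dlt f y x]| < 2 * K.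
  by move=> /hinc[c cC' cx]; apply: chain_types cx f.
have [[B [sB cB hB]]|small] :=
  pselect (exists B, [/\ B \subset ~: C, chain B & s < #|B|]).
  right.
  have BC b : b \in B -> b \notin C by move/(subsetP sB); rewrite inE.
  pose Bd f := [set b in B | K <= #|[set y in C | dlt f y b]|].
  have cBd f : #|Bd f| <= 2 * K.
    have [->|[b0 b0B]] := set_0Vmem (Bd f); first by rewrite cards0.
    (* The sets of elements of C on the side f of the points of Bd f are nested;
       the smallest of them is on the side f of all of Bd f. *)
    case: (arg_minnP (fun b => #|[set y in C | dlt f y b]|) b0B) => b bB hb.
    have {}bB : b \in Bd f by [].
    set D := [set y in C | dlt f y b] in hb.
    have [bB' bK] : b \in B /\ K <= #|D| by move: bB; rewrite inE => /andP[].
    have hD : {in D & Bd f, forall y b', dlt f y b'}.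
      move=> y b' yD b'B; have b'B' : b' \in B by move: b'B; rewrite inE
        => /andP[].
      move: (yD); rewrite inE => /andP[yC yb].
      have := cB _ _ bB' b'B'; rewrite (cmp_dlt f)
        => /or3P[/eqP<-//|/(dlt_trans yb)//|b'b].
      have sD : [set y in C | dlt f y b'] \subset D.
        by apply/subsetP=> t; rewrite !inE => /andP[-> /dlt_trans]; apply.
      have /eqP e : [set y in C | dlt f y b'] == D.
        by rewrite eqEcard sD hb.
      by move: yD; rewrite -e inE => /andP[].
    have : chain (D :|: Bd f).
      apply: chainU.
      - by apply: chainS cC; apply/subsetP=> y; rewrite inE => /andP[].
      - by apply: chainS cB; apply/subsetP=> y; rewrite inE => /andP[].
      - by move=> y b' yD b'B; apply/dlt_cmp/hD.
    move/maxC; rewrite card_disjointU ?(disjoint_dlt hD) //.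
    have := types _ f (BC _ bB') bK.
    have := cardsID [set y | dlt f y b] C.
    have -> : C :&: [set y | dlt f y b] = D by apply/setP=> y; rewrite !inE.
    have -> : C :\: [set y | dlt f y b] = [set y in C | ~~ dlt f y b].
      by apply/setP=> y; rewrite !inE andbC.
    by lia.
  pose B1 := B :\: (Bd true :|: Bd false).
  exists B1, (chain_core C K); split.
  - by apply: chainS cB; exact: subsetDl.
  - by apply: chainS cC; apply/subsetP=> y; rewrite inE => /andP[].
  - move=> b c /setDP[bB]; rewrite in_setU negb_or => /andP[b1 b2] cc.
    rewrite !inE bB /= in b1 b2; have [cC' _] := chain_coreP true cc.
    have lt f : dlt f c b -> K <= #|[set y in C | dlt f y b]|.
      move=> cb; have [_ h] := chain_coreP f cc; apply: leq_trans h _.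
      by apply/subset_leq_card/subsetP=> y; rewrite !inE
        => /andP[-> /dlt_trans]; apply.
    rewrite cmp_sym (cmp_dlt true); apply/negP=> /or3P[/eqP e|/lt h|].
    + by have := BC _ bB; rewrite -e cC'.
    + by rewrite h in b1.
    + by rewrite -dltN => /lt h; rewrite h in b2.
  - have := leq_cardsD B (Bd true :|: Bd false).
    have := leq_cardsU (Bd true) (Bd false).
    by have := cBd true; have := cBd false; rewrite -/B1 /s in hB *; lia.
  - by have := card_chain_core K cC; lia.
left; pose M := chain_core C (2 * K).
have cX : #|~: C| <= w * s.
  apply: hX => B sB cB; rewrite leqNgt; apply/negP=> h'.
  by apply: small; exists B.
have unif x : x \notin M -> (exists2 f, true & {in M, forall y, dlt f y x}) \/
    {in M, forall y, ~~ cmp y x}.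
  move=> xM; have [xC|xC] := boolP (x \in C).
    left.
    have low f : #|below f C x| < 2 * K -> {in M, forall y, dlt f x y}.
      move=> hx y yM; have [yC hy] := chain_coreP f yM.
      have nxy : y != x by apply: contraNneq xM => <-.
      apply: (chain_dlt cC yC xC nxy); apply/negP => yx.
      have := subset_leq_card (proper_sub (below_proper yC yx)); lia.
    move: xM; rewrite inE xC /= negb_and -!ltnNge => /orP[/low h|/low h].
      by exists false => // y /h.
    by exists true => // y /h.
  have core f : K <= #|[set y in C | dlt f y x]| -> {in M, forall y, dlt f y x}.
    move=> /(types _ _ xC) h y yM; have [yC hy] := chain_coreP (~~ f) yM.
    apply: contraT => nyx; move: h; rewrite ltnNge => /negP[].
    apply: leq_trans hy _; apply/subset_leq_card/subsetP=> t.
    rewrite !inE dltN => /andP[-> yt] /=; apply: contra nyx; exact: dlt_trans.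
  have [h|h1] := leqP K #|[set y in C | dlt true y x]|.
    by left; exists true => //; apply: core.
  have [h|h2] := leqP K #|[set y in C | dlt false y x]|.
    by left; exists false => //; apply: core.
  right=> y yM; apply/negP; rewrite (cmp_dlt true) => /or3P[/eqP e|yx|].
  - by move: xC; rewrite -e; have [->] := chain_coreP true yM.
  - have [yC hy] := chain_coreP true yM.
    suff : #|below true C y| <= #|[set y in C | dlt true y x]| by lia.
    by apply/subset_leq_card/subsetP=> t; rewrite !inE => /andP[-> /dlt_trans];
      apply.
  - rewrite -dltN /= => yx; have [yC hy] := chain_coreP false yM.
    suff : #|below false C y| <= #|[set y in C | dlt false y x]| by lia.
    apply/subset_leq_card/subsetP=> t; rewrite !inE => /andP[-> h] /=.
    exact: (@dlt_trans _ _ false _ _ _ h yx).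
exists true, M; split.
  split; first by apply: chainS cC; apply/subsetP=> y; rewrite inE => /andP[].
  move=> x y z /unif[[[] _ h]|h] yM zM.
  - have := h _ yM; have := h _ zM; rewrite /= => hz hy.
    by rewrite (ltW hy) (ltW hz) (lt_geF hy) (lt_geF hz).
  - have := h _ yM; have := h _ zM; rewrite /= => hz hy.
    by rewrite (ltW hy) (ltW hz) (lt_geF hy) (lt_geF hz).
  - have inc t : t \in M -> (x <= t)%O = false /\ (t <= x)%O = false.
      move=> /h nc; split; apply: contraNF nc => /le_comparable //.
      by rewrite cmp_sym.
    by have [-> ->] := inc _ yM; have [-> ->] := inc _ zM.
have := card_chain_core (2 * K) cC; rewrite -/M.
by have := cardsC C; have := cardsC M; lia.
Qed.

Lemma chain_or_antichain_bounded : (forall C, chain C -> #|C| <= 3 * K) \/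
  (forall A, antichain A -> #|A| <= 2 * K * K + K).
Proof.
have [h|/existsNP[C /not_implyP[cC /negP]]] :=
  pselect (forall C, chain C -> #|C| <= 3 * K); first by left.
rewrite -ltnNge => hC; right => A aA; rewrite leqNgt; apply/negP => hA.
by apply: (no_long_antichain_and_chain aA cC); lia.
Qed.

Definition module_bound m := antichain_module_bound (3 * K) m +
  chain_module_bound (2 * K * K + K) m.

(** The dichotomy at the heart of the theorem: the bound does not depend on
    T. *)
Lemma module_or_half_family m :
  (exists kind M, homogeneous kind M /\ #|~: M| <= module_bound m) \/
  has_matching m \/ has_two_chains m.
Proof.
have [h|h] := chain_or_antichain_bounded.
  have [[kind [M [hM cM]]]|?] := antichain_module m h; last by right; left.
  by left; exists kind, M; split => //; apply: leq_trans cM (leq_addr _ _).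
have [[kind [M [hM cM]]]|?] := chain_module m h; last by right; right.
by left; exists kind, M; split => //; apply: leq_trans cM (leq_addl _ _).
Qed.

End Structure.

(** * Rigidity of large matchings and of large unrelated chains *)

Section ExactShape.
Context {d : Order.disp_t} {T : finPOrderType d}.
Implicit Types (x y z : T) (A B C D I M S X Q : {set T}) (f : bool).

(** The extensions of a matching by which K./2.+1 classes become K. *)
Record no_matching_extra (K : nat) : Prop := NoMatchingExtra {
  no_cone : forall f z X (q p : T -> T), matching X q p -> K <= #|X| ->
    ~ {in X, forall i, dlt f (q i) z /\ dlt f (p i) z};
  no_far_branching : forall Q X (q p : T -> T), matching X q p -> K <= #|X| ->
    #|Q| = 3 -> branching Q -> ~ unrelated Q (q @: X :|: p @: X)
}.

(** The extensions of two unrelated chains by which K./2.+1 classes become K. *)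
Record no_two_chains_extra (K : nat) : Prop := NoTwoChainsExtra {
  no_point : forall (e : bool) z C1 C2, chain C1 -> chain C2 ->
    unrelated C1 C2 -> K <= #|C1| -> K <= #|C2| ->
    z \notin C1 :|: C2 -> ~ {in C1 :|: C2, forall c, cmp c z = e};
  no_twin : forall y z D C1 C2, chain C1 -> chain C2 -> unrelated C1 C2 ->
    K <= #|C1| -> K <= #|C2| -> D \subset C1 -> K <= #|D| ->
    {in D, forall c, cmp c y /\ cmp c z} -> ~~ cmp y z ->
    ~ unrelated [set y; z] C2;
  no_zigzag : forall w z D I, chain D -> chain I -> unrelated D I ->
    K <= #|D| -> K <= #|I| -> {in D, forall c, cmp c z /\ ~~ cmp c w} ->
    {in I, forall c, cmp c w /\ ~~ cmp c z} -> ~ cmp z w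
}.

Variables (K : nat) (K0 : 0 < K) (exc : no_linear_family (T := T) K).

Section Matching.
Hypothesis nme : no_matching_extra K.

Lemma matching_inj X (q p : T -> T) : matching X q p -> {in X &, injective q}.
Proof.
move=> m i j iX jX e; have [h _ _ _] := m _ _ iX jX.
by apply/eqP; rewrite -h e comparablexx.
Qed.

Lemma matching_antichain X Y (q p : T -> T) : matching (X :|: Y) q p ->
  [disjoint X & Y] -> antichain (q @: X :|: p @: Y).
Proof.
move=> m dXY; have inX i : i \in X -> i \in X :|: Y by rewrite inE => ->.
have inY i : i \in Y -> i \in X :|: Y by rewrite inE orbC => ->.
apply: antichainU.
- move=> _ _ /imsetP[i /inX iX ->] /imsetP[j /inX jX ->].
  by have [-> _ _ _] := m _ _ iX jX => /eqP->.
- move=> _ _ /imsetP[i /inY iX ->] /imsetP[j /inY jX ->].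
  by have [_ -> _ _] := m _ _ iX jX => /eqP->.
- move=> _ _ /imsetP[i iX ->] /imsetP[j jY ->].
  have [_ _ -> _] := m _ _ (inX _ iX) (inY _ jY).
  by apply: contraTneq jY => <-; rewrite (disjointFr dXY).
Qed.

(** Transversals of a matching are antichains. If z is on one side of K of the q
    i, then applying no_antichain_split to the antichain q @: X, and to the one
    obtained by replacing the other q i with p i, puts z on that side of both
    points of all but 3 * K pairs, and no_cone applies. *)
Lemma matching_few_dominated f z X (q p : T -> T) : matching X q p ->
  4 * K <= #|X| -> #|[set i in X | dlt f (q i) z]| < K.
Proof.
move=> m nX; rewrite ltnNge; apply/negP=> /subset_of_card[I sI cI].
have hI i : i \in I -> i \in X /\ dlt f (q i) z.
  by move/(subsetP sI); rewrite inE => /andP[].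
have sIX : I \subset X by apply/subsetP=> i /hI[].
have iq := matching_inj m; have ip := matching_inj (matching_sym m).
have key (Y : {set T}) : Y \subset X -> [disjoint I & Y] ->
    {in q @: I :|: p @: Y, forall a, dlt f a z = cmp a z} /\
    #|[set i in Y | ~~ dlt f (p i) z]| < K.
  move=> sY dIY; have aA := matching_antichain (matchingS (Y := I :|: Y) _ m)
    dIY.
  set A := q @: I :|: p @: Y in aA *.
  have {}aA : antichain A by apply: aA; rewrite subUset sIX.
  have hD : K <= #|[set a in A | dlt f a z]|.
    rewrite -cI -(card_in_imset (f := q)); last first.
      by move=> i j /(subsetP sIX) iX /(subsetP sIX) jX; apply: iq.
    apply/subset_leq_card/subsetP=> _ /imsetP[i iI ->].
    by rewrite !inE imset_f //; have [_] := hI _ iI.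
  have hE := antichain_dominatedE aA (leq_trans K0 hD); split => //.
  apply: leq_ltn_trans (no_antichain_split exc aA hD).
  rewrite -(card_in_imset (f := p)); last first.
    by move=> i j; rewrite !inE => /andP[/(subsetP sY) iX _]
      /andP[/(subsetP sY) jX _]; apply: ip.
  apply/subset_leq_card/subsetP=> _ /imsetP[i + ->]; rewrite inE
    => /andP[iY hi].
  have piA : p i \in A by rewrite inE orbC imset_f.
  by rewrite inE piA -hE.
have aX : antichain (q @: X).
  rewrite -[q @: X]setU0 -(imset0 p); apply: matching_antichain;
    rewrite ?setU0 //.
  by rewrite disjoint_sym disjoints_subset sub0set.
have hqX : K <= #|[set a in q @: X | dlt f a z]|.
  rewrite -cI -(card_in_imset (f := q)); last first.
    by move=> i j /(subsetP sIX) iX /(subsetP sIX) jX; apply: iq.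
  apply/subset_leq_card/subsetP=> _ /imsetP[i iI ->].
  by have [iX hi] := hI _ iI; rewrite !inE imset_f.
have hU : #|[set i in X | ~~ dlt f (q i) z]| < K.
  apply: leq_ltn_trans (no_antichain_split exc aX hqX).
  have hE := antichain_dominatedE aX (leq_trans K0 hqX).
  rewrite -(card_in_imset (f := q)); last first.
    by move=> i j; rewrite !inE => /andP[iX _] /andP[jX _]; apply: iq.
  apply/subset_leq_card/subsetP=> _ /imsetP[i + ->]; rewrite inE
    => /andP[iY hi].
  by rewrite inE -hE imset_f.
have [|_ hV] := key (X :\: I) (subsetDl _ _).
  by rewrite disjoint_sym disjoints_subset; apply/subsetP=> i; rewrite !inE
    => /andP[].
set U := [set i in X | ~~ dlt f (q i) z] in hU.
set V := [set i in X :\: I | ~~ dlt f (p i) z] in hV.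
(* These are pairs with both points on the side f of z. *)
pose W := X :\: (I :|: (U :|: V)).
have sW : W \subset X by exact: subsetDl.
apply: (no_cone nme (f := f) (z := z) (matchingS sW m)).
  have := leq_cardsD X (I :|: (U :|: V)); have := leq_cardsU I (U :|: V).
  by have := leq_cardsU U V; rewrite -/W; lia.
move=> i; rewrite !inE; case: (i \in X); rewrite ?andbF //= ?andbT.
by case: (i \in I); case: (dlt f (q i) z); case: (dlt f (p i) z).
Qed.

Lemma matching_touch z X (q p : T -> T) : matching X q p -> 4 * K <= #|X| ->
  #|[set i in X | cmp (q i) z || cmp (p i) z]| <= 6 * K.
Proof.
move=> m nX; have m' := matching_sym m.
have one r s : matching X r s -> #|[set i in X | cmp (r i) z]| <= 3 * K.
  move=> mr; have ir := matching_inj mr.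
  have : [set i in X | cmp (r i) z] \subset [set i in X | r i == z] :|:
    ([set i in X | dlt true (r i) z] :|: [set i in X | dlt false (r i) z]).
    by apply/subsetP=> i; rewrite !inE (cmp_dlt true) /=
      => /andP[-> /or3P[] ->];
      rewrite ?orbT.
  move/subset_leq_card.
  have := leq_cardsU [set i in X | r i == z]
    ([set i in X | dlt true (r i) z] :|: [set i in X | dlt false (r i) z]).
  have := leq_cardsU [set i in X | dlt true (r i) z]
    [set i in X | dlt false (r i) z].
  have := matching_few_dominated true z mr nX.
  have := matching_few_dominated false z mr nX.
  have : #|[set i in X | r i == z]| <= 1.
    apply/card_le1P => i; rewrite inE => /andP[iX /eqP e] j; rewrite !inE.
    apply/andP/eqP => [[jX /eqP e']|->]; last by rewrite iX e.
    by apply: ir => //; rewrite e.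
  by lia.
have : [set i in X | cmp (q i) z || cmp (p i) z] \subset
    [set i in X | cmp (q i) z] :|: [set i in X | cmp (p i) z].
  by apply/subsetP=> i; rewrite !inE => /andP[->].
move/subset_leq_card; have := one _ _ m; have := one _ _ m'.
by have := leq_cardsU [set i in X | cmp (q i) z] [set i in X | cmp (p i) z];
  lia.
Qed.

(** The three points of a branching touch at most 18 * K pairs; the K remaining
    pairs are far from the branching. *)
Lemma matching_exact : has_matching (T := T) (19 * K) -> ~~ branching [set: T].
Proof.
move=> [X [q [p [m nX]]]]; apply/negP.
case/existsP=> x /andP[_ /existsP[y /andP[_ /existsP[z /andP[_]]]]]
  /and5P[xy xz yz cxy cxz].
pose Q := [set x; y; z].
have cQ : #|Q| = 3 by rewrite /Q setUC cardsU1 !inE negb_or !(eq_sym z) xz yz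
  cards2 xy.
pose N z := [set i in X | cmp (q i) z || cmp (p i) z].
pose W := X :\: \bigcup_(u in Q) N u.
have sW : W \subset X by exact: subsetDl.
apply: (no_far_branching nme (matchingS sW m) _ cQ).
- apply: (@avoid_nbrs _ _ _ _ _ (6 * K)) => [u _|]; last by rewrite cQ; lia.
  by apply: matching_touch => //; lia.
- by apply: (@branchingP _ _ x y z); rewrite ?inE ?eqxx ?orbT.
- move=> u v uQ; rewrite inE => vW; apply/negP=> cuv.
  case/orP: vW => /imsetP[i /setDP[iX /bigcupP nU] ev]; apply: nU;
    exists u => //.
    by rewrite inE iX -ev cmp_sym cuv.
  by rewrite inE iX -ev [cmp v u]cmp_sym cuv orbT.
Qed.

End Matching.

Section TwoChains.
Hypothesis nce : no_two_chains_extra K.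

(** A point with K elements of C1 on one side can only extend C1. It has nothing
    of C2 beyond it, by transitivity; no_point leaves less than K elements of C2
    on its near side; no_zigzag then excludes all comparabilities to C2, and
    no_twin the elements of C1 incomparable to z. *)
Lemma two_chains_absorb f z C1 C2 : chain C1 -> chain C2 -> unrelated C1 C2 ->
  3 * K <= #|C1| -> 3 * K <= #|C2| -> z \notin C1 :|: C2 ->
  K <= #|[set c in C1 | dlt f c z]| ->
  {in C1, forall c, cmp c z} /\ {in C2, forall c, ~~ cmp c z}.
Proof.
move=> cC1 cC2 u n1 n2 zC hD; set D1 := [set c in C1 | _] in hD.
have sD1 : D1 \subset C1 by apply/subsetP=> c; rewrite inE => /andP[].
have hD1 c : c \in D1 -> c \in C1 /\ dlt f c z by rewrite inE => /andP[].
have cD1 := chainS sD1 cC1.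
have [zC1 zC2] : z \notin C1 /\ z \notin C2.
  by move: zC; rewrite inE negb_or => /andP[].
have /card_gt0P[c1 /hD1[c1C c1z]] : 0 < #|D1| by lia.
have nU2 c : c \in C2 -> ~~ dlt f z c.
  move=> cC; apply/negP=> /(dlt_trans c1z) /dlt_cmp h.
  by have := u _ _ c1C cC; rewrite h.
pose D2 := [set c in C2 | dlt f c z]; pose I2 := [set c in C2 | ~~ cmp c z].
have sD2 : D2 \subset C2 by apply/subsetP=> c; rewrite inE => /andP[].
have sI2 : I2 \subset C2 by apply/subsetP=> c; rewrite inE => /andP[].
have D2K : #|D2| < K.
  rewrite ltnNge; apply/negP=> h.
  apply: (no_point nce cD1 (chainS sD2 cC2) (unrelatedS sD1 sD2 u) hD h
    (e := true) (z := z)).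
    by rewrite !inE (negPf zC1) (negPf zC2).
  by move=> c; rewrite !inE => /orP[] /andP[_ /dlt_cmp].
have I2K : K <= #|I2|.
  have : C2 \subset D2 :|: I2.
    apply/subsetP=> c cC; rewrite !inE cC /= (cmp_dlt f) (negPf (nU2 _ cC))
      orbF.
    by case: eqP => [e|_]; [rewrite -e cC in zC2 | rewrite /= orbN].
  by move/subset_leq_card; have := leq_cardsU D2 I2; lia.
have inc2 : {in C2, forall c, ~~ cmp c z}.
  move=> w wC; apply/negP=> wz.
  apply: (no_zigzag nce cD1 (chainS sI2 cC2) (unrelatedS sD1 sI2 u) hD I2K
    (w := w) (z := z)).
  - by move=> c /hD1[cC /dlt_cmp cz]; split => //; apply: u.
  - by move=> c; rewrite inE => /andP[cC cz]; split => //; apply: cC2.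
  - by rewrite cmp_sym.
split=> // c cC; apply/negPn/negP=> cz.
have k1 : K <= #|C1| by apply: leq_trans n1; rewrite leq_pmull.
have k2 : K <= #|C2| by apply: leq_trans n2; rewrite leq_pmull.
apply: (no_twin nce cC1 cC2 u k1 k2 sD1 hD (y := c) (z := z)) => //.
  by move=> c' /hD1[c'C /dlt_cmp c'z]; split => //; apply: cC1.
move=> y c2; rewrite !inE => /orP[] /eqP-> c2C; first exact: u.
by rewrite cmp_sym inc2.
Qed.

(** Choose the two chains with the largest possible union: a further point would
    be absorbed by one of them, or be incomparable to K elements of each. *)
Lemma two_chains_exact : has_two_chains (T := T) (3 * K) ->
  exists C, forall x y, cmp x y = ((x \in C) == (y \in C)).
Proof.
move=> [C10 [C20 [cC10 cC20 u0 n10 n20]]].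
pose R S := exists C1 C2, [/\ chain C1, chain C2, unrelated C1 C2,
  3 * K <= #|C1| /\ 3 * K <= #|C2| & S = C1 :|: C2].
have [S [C1 [C2 [cC1 cC2 u [n1 n2] eS]]] maxS] := @exists_max _ _ R
  (C10 :|: C20)
  ltac:(by exists C10, C20).
have grow C C' z : chain C -> chain C' -> unrelated C C' -> 3 * K <= #|C| ->
    3 * K <= #|C'| -> C1 :|: C2 = C :|: C' -> z \notin C :|: C' ->
    {in C, forall c, cmp c z} -> {in C', forall c, ~~ cmp c z} -> False.
  move=> cC cC' u' n n' e zC h h'.
  suff /maxS : R (z |: (C :|: C')) by rewrite cardsU1 zC -e -eS ltnn.
  exists (z |: C), C'; split => //; last by rewrite setUA.
  - apply: chainU => // [|x y /set1P-> yC]; first exact: chain1.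
    by rewrite cmp_sym h.
  - by move=> x y; rewrite in_setU1 => /orP[/eqP->|xC] yC;
    [rewrite cmp_sym h' | exact: u'].
  - by split => //; apply: leq_trans n _; apply: subset_leq_card;
    exact: subsetUr.
have full z : z \in C1 :|: C2.
  apply/negPn/negP=> zC.
  have [zC1 zC2] : z \notin C1 /\ z \notin C2.
    by move: zC; rewrite inE negb_or => /andP[].
  pose I C := [set c in C | ~~ cmp c z].
  have sI C : I C \subset C by apply/subsetP=> c; rewrite inE => /andP[].
  have split3 C : z \notin C -> 3 * K <= #|C| ->
      (exists f, K <= #|[set c in C | dlt f c z]|) \/ K <= #|I C|.
    move=> zC' n; have [h|h1] := leqP K #|[set c in C | dlt true c z]|.
      by left; exists true.
    have [h|h2] := leqP K #|[set c in C | dlt false c z]|.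
      by left; exists false.
    right; have : C \subset I C :|:
      ([set c in C | dlt true c z] :|: [set c in C | dlt false c z]).
      apply/subsetP=> c cC; rewrite !inE cC /= (cmp_dlt true).
      have -> : (c == z) = false by apply: contraNF zC' => /eqP<-.
      by rewrite orNb.
    move/subset_leq_card; have := leq_cardsU (I C)
      ([set c in C | dlt true c z] :|: [set c in C | dlt false c z]).
    by have := leq_cardsU [set c in C | dlt true c z]
      [set c in C | dlt false c z]; lia.
  have [[f h]|h1] := split3 _ zC1 n1.
    have [h1 h2] := two_chains_absorb cC1 cC2 u n1 n2 zC h.
    exact: (grow C1 C2 z).
  have [[f h]|h2] := split3 _ zC2 n2.
    have e := setUC C1 C2; rewrite e in zC; have u' := unrelated_sym u.
    have [h3 h4] := two_chains_absorb cC2 cC1 u' n2 n1 zC h.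
    exact: (grow C2 C1 z).
  apply: (no_point nce (chainS (sI C1) cC1) (chainS (sI C2) cC2)
    (unrelatedS (sI C1) (sI C2) u) h1 h2 (e := false) (z := z)).
    by rewrite !inE (negPf zC1) (negPf zC2).
  by move=> c; rewrite !inE => /orP[] /andP[_ /negPf].
exists C1 => x y; have dj z : z \in C2 -> (z \in C1) = false.
  by move=> zB; apply: (disjointFl (unrelated_disjoint u) zB).
have := full x; have := full y; rewrite !inE => /orP[hy|hy] /orP[hx|hx].
- by rewrite hx hy cC1.
- by rewrite hy (dj _ hx) cmp_sym (negPf (u _ _ hy hx)).
- by rewrite hx (dj _ hy) (negPf (u _ _ hx hy)).
- by rewrite !dj // cC2.
Qed.

End TwoChains.
End ExactShape.

(** * Codes of posets and upper bounds on the speed *)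

(** Isomorphism classes are disjoint sets of labelled orders, so a set of
    labelled orders that meets all of them is at least as large as their
    number. *)
Lemma speed_le P n (code : finType) (mk : code -> {set 'I_n * 'I_n}) :
  (forall d (T : finPOrderType d), P d T -> #|T| = n ->
    exists c, mk c \in iso_class n T) ->
  speed P n <= #|code|.
Proof.
move=> h; rewrite /speed.
have cls C : C \in iso_classes P n -> exists c, mk c \in C.
  by rewrite inE => /asboolP[d [T [PT cT ->]]]; apply: h.
have same C C' r : C \in iso_classes P n -> C' \in iso_classes P n ->
    r \in C -> r \in C' -> C = C'.
  rewrite !inE => /asboolP[d [T [PT cT ->]]] /asboolP[d' [T' [PT' cT' ->]]].
  rewrite !inE => /asboolP[f [g fK gK] hf] /asboolP[f' bf' hf'].
  apply/(iso_class_eqP _ cT); exists (f' \o g).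
    by apply: bij_comp => //; exists f.
  by move=> x y; rewrite /= -hf' hf !gK.
pose F (C : {set {set 'I_n * 'I_n}}) := [pick c | mk c \in C].
have hF C : C \in iso_classes P n -> exists2 c, F C = Some c & mk c \in C.
  move=> /cls[c hc]; rewrite /F; case: pickP => [c' hc'|/(_ c)];
    first by exists c'.
  by rewrite hc.
have [F0|/card_gt0P[C0 /cls[c0 _]]] := posnP #|iso_classes P n|;
  first by rewrite F0.
apply: (@leq_card_in _ _ (fun C => odflt c0 (F C))) => C C' hC hC'.
have [c -> hc] := hF _ hC; have [c' -> hc'] := hF _ hC' => /= e.
by apply: (same _ _ (mk c)) => //; rewrite e.
Qed.

Definition rel_set n (R : rel nat) := [set p : 'I_n * 'I_n | R p.1 p.2].

(** Since R (g x) (g x) holds by reflexivity of the order, a labelling g that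
    transports the order to R is automatically injective. *)
Lemma rel_set_iso_class n (R : rel nat) d (T : finPOrderType d) (g : T -> nat) :
  #|T| = n -> (forall x, g x < n) ->
  (forall x y, (x <= y)%O = R (g x) (g y)) -> rel_set n R \in iso_class n T.
Proof.
move=> cT gn hR; pose g' x := Ordinal (gn x).
have ig : injective g'.
  move=> x y /(congr1 val) /= e; apply/le_anti.
  by rewrite (hR x y) (hR y x) -e -(hR x x) lexx.
have [f fK gK] : bijective g' by apply: inj_card_bij => //; rewrite card_ord cT.
rewrite inE; apply/asboolP; exists f; first by exists g'.
by move=> i j; rewrite inE hR /= -[in LHS](gK i) -[in LHS](gK j).
Qed.

Definition rank (T : finType) (A : {set T}) (x : T) := index x (enum A).

Lemma rank_lt (T : finType) (A : {set T}) x : (rank A x < #|A|) = (x \in A).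
Proof. by rewrite /rank cardE index_mem mem_enum. Qed.

Lemma rank_inj (T : finType) (A : {set T}) : {in A &, injective (rank A)}.
Proof.
move=> x y xA yA e.
by rewrite -(nth_index x (_ : x \in enum A)) ?mem_enum // -/(rank A x) e
  nth_index ?mem_enum.
Qed.

Lemma homogeneous_rank d (T : finPOrderType d) kind (M : {set T}) :
  homogeneous kind M -> exists g : T -> nat, {in M, forall x, g x < #|M|} /\
    {in M &, forall x y, (x <= y)%O = if kind then g x <= g y else g x == g y}.
Proof.
case; case: kind => hM _.
  exists (fun x => #|below true M x|); split; first by move=> x;
    apply: below_lt.
  by move=> x y xM yM; rewrite (chain_rank hM).
exists (rank M); split=> [x|x y xM yM]; first by rewrite rank_lt.
apply/idP/eqP => [/le_comparable /(hM _ _ xM yM)->//|/(rank_inj xM yM)->].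
exact: lexx.
Qed.

Section ModuleCode.
Variable L : nat.
Notation code := (bool * 'I_L.+1 * {set 'I_L.+1 * 'I_L.+1})%type.

(** In a code (kind, j, R), the labels from j on are the module. Truncating the
    labels at j collapses the module to the point j, and R describes the
    collapsed poset, of at most L.+1 points. *)
Definition module_rel (c : code) : rel nat := fun a b =>
  let j : nat := c.1.2 in
  if (j <= a) && (j <= b) then if c.1.1 then a <= b else a == b
  else (inord (minn a j), inord (minn b j)) \in c.2.

Lemma module_code n d (T : finPOrderType d) kind (M : {set T}) :
  #|T| = n -> homogeneous kind M -> #|~: M| <= L ->
  exists c, rel_set n (module_rel c) \in iso_class n T.
Proof.
move=> cT hM cM; have [rk [rkM rkE]] := homogeneous_rank hM.
set j := #|~: M| in cM.
pose g x := if x \in M then j + rk x else rank (~: M) x.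
have gM x : (j <= g x) = (x \in M).
  rewrite /g; case: ifP => [_|/negbT h]; first by rewrite leq_addr.
  by rewrite leqNgt rank_lt inE h.
pose k x := inord (minn (g x) j) : 'I_L.+1.
have kM x : minn (g x) j < L.+1 by rewrite ltnS (leq_trans (geq_minr _ _)).
have keq x y : k x = k y -> x = y \/ x \in M /\ y \in M.
  move=> /(congr1 val); rewrite /= !inordK // => e.
  have [xM|xM] := boolP (x \in M).
    right; split => //; rewrite -gM; have : j <= g x by rewrite gM.
    by lia.
  have gx : ~~ (j <= g x) by rewrite gM.
  have gy : ~~ (j <= g y) by lia.
  left; have yM : y \notin M by rewrite -gM.
  apply: (@rank_inj _ (~: M)); rewrite ?inE //.
  by move: e gx gy; rewrite /g (negPf xM) (negPf yM); lia.
pose R := [set p : 'I_L.+1 * 'I_L.+1 | [exists x, exists y,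
  [&& k x == p.1, k y == p.2, (x <= y)%O & ~~ ((x \in M) && (y \in M))]]].
have jL : j < L.+1 by [].
exists (kind, Ordinal jL, R); apply: (rel_set_iso_class (g := g)) => // [x|x y].
  rewrite -cT -(cardsC M) -/j addnC /g; case: ifPn => xM.
    by rewrite ltn_add2l rkM.
  by apply: ltn_addr; rewrite /j rank_lt inE.
rewrite /module_rel /= !gM; case: ifPn => [/andP[xM yM]|nM].
  by rewrite rkE // /g xM yM leq_add2l eqn_add2l.
rewrite inE; apply/idP/existsP
  => [xy|[x' /existsP[y' /and4P[/eqP ex /eqP ey xy nM']]]].
  by exists x; apply/existsP; exists y; rewrite !eqxx xy.
have [_ hU] := hM.
case: (keq _ _ ex) => [e|[x'M xM]]; case: (keq _ _ ey) => [e'|[y'M yM]].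
- by rewrite -e -e'.
- have x'M : x' \notin M by apply: contra nM' => ->.
  by rewrite -e -(hU _ _ _ x'M y'M yM).1.
- have y'M : y' \notin M by apply: contra nM'; rewrite x'M.
  by rewrite -e' -(hU _ _ _ y'M x'M xM).2.
- by rewrite x'M y'M in nM'.
Qed.

End ModuleCode.

Definition two_chains_rel (k : nat) : rel nat :=
  fun a b => ((a < k) == (b < k)) && (a <= b).

Lemma two_chains_code n d (T : finPOrderType d) (C : {set T}) : #|T| = n ->
  (forall x y, cmp x y = ((x \in C) == (y \in C))) ->
  exists k : 'I_n./2.+1, rel_set n (two_chains_rel k) \in iso_class n T.
Proof.
move=> cT; wlog leC : C / #|C| <= #|~: C|.
  move=> h hC; have [|/ltnW le] := leqP #|C| #|~: C|; first by move=> /h; apply.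
  apply: (h (~: C)); first by rewrite setCK.
  by move=> x y; rewrite hC !inE; case: (x \in C); case: (y \in C).
move=> hC; have cC : chain C by move=> x y xC yC; rewrite hC xC yC.
have cD : chain (~: C).
  by move=> x y; rewrite !inE hC => /negPf-> /negPf->.
have hn : #|C| + #|~: C| = n by rewrite cardsC.
have ck : #|C| < n./2.+1 by lia.
pose g x := if x \in C then #|below true C x| else #|C| + #|below true (~: C)
  x|.
have gC x : (g x < #|C|) = (x \in C).
  rewrite /g; case: ifP => [xC|_]; first by rewrite below_lt.
  by rewrite ltnNge leq_addr.
exists (Ordinal ck); apply: (rel_set_iso_class (g := g)) => // [x|x y].
  rewrite -hn /g; case: ifPn => xC; first by apply: ltn_addr; apply: below_lt.
  by rewrite ltn_add2l below_lt // inE.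
rewrite /two_chains_rel /= !gC; have := hC x y.
rewrite /g; case: (boolP (x \in C)) => xC; case: (boolP (y \in C)) => yC /= hxy.
- by rewrite -chain_rank.
- by apply/negP=> /le_comparable; rewrite hxy.
- by apply/negP=> /le_comparable; rewrite hxy.
- by rewrite leq_add2l -chain_rank // inE.
Qed.

Definition matching_rel (k : nat) : rel nat :=
  fun a b => (a == b) || (a < k) && (b == a + k).

Lemma matching_code n d (T : finPOrderType d) : #|T| = n ->
  ~~ branching [set: T] ->
  exists k : 'I_n./2.+1, rel_set n (matching_rel k) \in iso_class n T.
Proof.
move=> cT nb.
have uniq (x y z : T) : cmp x y -> cmp x z -> x != y -> x != z -> y = z.
  move=> h1 h2 n1 n2; apply/eqP; apply: contraNT nb => n3.
  by apply: (@branchingP _ _ x y z); rewrite ?inE.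
have uniqlt (x y z : T) : (x < y)%O -> cmp x z -> x != z -> y = z.
  by move=> h cz nz; apply: (uniq x) => //; rewrite ?le_comparable ?ltW ?lt_eqF.
have uniqgt (x y z : T) : (y < x)%O -> cmp x z -> x != z -> y = z.
  by move=> h cz nz; apply: (uniq x) => //; rewrite ?(cmp_sym x) ?le_comparable
    ?ltW ?gt_eqF.
pose X := [set x : T | [exists y, (x < y)%O]].
pose Y := [set y : T | [exists x, (x < y)%O]].
pose q (y : T) := odflt y [pick x | (x < y)%O].
have qY y : y \in Y -> (q y < y)%O.
  rewrite inE => /existsP[x xy]; rewrite /q; case: pickP => //= /(_ x).
  by rewrite xy.
have qX y : y \in Y -> q y \in X.
  by move=> /qY h; rewrite inE; apply/existsP; exists y.
have qE (x y : T) : (x < y)%O -> q y = x.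
  move=> xy; have yY : y \in Y by rewrite inE; apply/existsP; exists x.
  apply: (uniqgt y _ _ (qY _ yY)); last by rewrite gt_eqF.
  by rewrite cmp_sym le_comparable // ltW.
have XY x : x \in X -> x \in Y -> False.
  rewrite inE => /existsP[y xy] xY; have h := qY _ xY.
  have e : y = q x.
    apply: (uniqlt x _ _ xy); last by rewrite gt_eqF.
    by rewrite cmp_sym le_comparable // ltW.
  by have := lt_trans xy (eq_ind_r (fun y => (y < x)%O) h e); rewrite ltxx.
have qinj : {in Y &, injective q}.
  move=> y y' yY y'Y e; apply: (uniqlt (q y)); first exact: qY.
    by rewrite e le_comparable // ltW // qY.
  by rewrite e lt_eqF // qY.
have imq : q @: Y = X.
  apply/setP=> x; apply/imsetP/idP => [[y /qX yX ->]//|].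
  rewrite inE => /existsP[y xy]; exists y; last by rewrite (qE x).
  by rewrite inE; apply/existsP; exists x.
have cY : #|Y| = #|X| by rewrite -imq card_in_imset.
have dXY : [disjoint X & Y].
  by rewrite disjoints_subset; apply/subsetP=> x xX; rewrite inE;
    apply/negP=> /(XY _ xX).
pose Z := ~: (X :|: Y).
have hn : #|X| + #|X| + #|Z| = n.
  by rewrite -[in X in _ + X + _ = _]cY -card_disjointU // cardsC.
have ck : #|X| < n./2.+1 by lia.
pose g x := if x \in X then rank X x else
  if x \in Y then #|X| + rank X (q x) else #|X| + #|X| + rank Z x.
have gX x : (g x < #|X|) = (x \in X).
  rewrite /g; case: ifP => [xX|_]; first by rewrite rank_lt.
  by case: ifP => _; rewrite ltnNge -?addnA leq_addr.
have gY x : x \notin X -> (g x < #|X| + #|X|) = (x \in Y).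
  move=> /negPf xX; rewrite /g xX; case: ifP => [xY|_].
    by rewrite ltn_add2l rank_lt qX.
  by rewrite ltnNge leq_addr.
have ginj : injective g.
  move=> x y e.
  have eX : (x \in X) = (y \in X) by rewrite -!gX e.
  have [xX|xX] := boolP (x \in X).
    have yX : y \in X by rewrite -eX.
    by move: e; rewrite /g xX yX => /rank_inj; apply.
  have yX : y \notin X by rewrite -eX.
  have eY : (x \in Y) = (y \in Y) by rewrite -!gY ?e.
  move: e; rewrite /g (negPf xX) (negPf yX) -eY; case: ifPn => xY.
    have yY : y \in Y by rewrite -eY.
    by move=> /addnI /rank_inj e; apply: qinj => //; apply: e; apply: qX.
  have yY : y \notin Y by rewrite -eY.
  by move=> /addnI /rank_inj; apply; rewrite in_setC in_setU negb_or ?xX ?xY ?yX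
    ?yY.
exists (Ordinal ck); apply: (rel_set_iso_class (g := g)) => // [x|x y].
  rewrite -hn; have [xX|xX] := boolP (x \in X).
    by rewrite -addnA ltn_addr // gX.
  have [xY|xY] := boolP (x \in Y); first by rewrite ltn_addr // gY.
  by rewrite /g (negPf xX) (negPf xY) ltn_add2l rank_lt in_setC in_setU negb_or
    xX.
rewrite /matching_rel /= (inj_eq ginj) le_eqVlt; congr orb.
rewrite gX; apply/idP/andP => [xy|[xX /eqP e]].
  have xX : x \in X by rewrite inE; apply/existsP; exists y.
  have yY : y \in Y by rewrite inE; apply/existsP; exists x.
  have yX : y \notin X by apply/negP=> /XY; apply.
  by split => //; rewrite /g xX (negPf yX) yY (qE x) // addnC.
have yX : y \notin X by rewrite -gX e ltnNge leq_addl.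
have yY : y \in Y by rewrite -gY // e ltn_add2r gX.
move: e; rewrite /g (negPf yX) yY xX addnC => /addIn /rank_inj e.
by rewrite -e ?qX // qY.
Qed.

(** Ordinal sum of an antichain of k points and an antichain of the others. *)
Definition cut_rel (k : nat) : rel nat := fun a b => (a == b) || (a < k <= b).

(** The labels run over 'I_n although A may have n + 1 sizes: A empty and A full
    both give the antichain. *)
Lemma cut_code n d (T : finPOrderType d) (A : {set T}) : 0 < n -> #|T| = n ->
  (forall x y, (x < y)%O = (x \in A) && (y \notin A)) ->
  exists k : 'I_n, rel_set n (cut_rel k) \in iso_class n T.
Proof.
move=> n0 cT; wlog ck : A / #|A| < n.
  move=> h hA; have [lt|ge] := ltnP #|A| n; first exact: (h A).
  have AT : A = [set: T].
    by apply/eqP; rewrite eqEcard subsetT cardsT cT.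
  apply: (h set0); first by rewrite cards0.
  by move=> x y; rewrite hA AT !inE.
move=> hA; pose g x := if x \in A then rank A x else #|A| + rank (~: A) x.
have gA x : (g x < #|A|) = (x \in A).
  rewrite /g; case: ifP => [xA|_]; first by rewrite rank_lt.
  by rewrite ltnNge leq_addr.
exists (Ordinal ck); apply: (rel_set_iso_class (g := g)) => // [x|x y].
  rewrite -cT -(cardsC A) /g; case: ifPn => xA; first by rewrite ltn_addr
    ?rank_lt.
  by rewrite ltn_add2l rank_lt inE.
rewrite /cut_rel /= [#|A| <= _]leqNgt !gA -hA le_eqVlt; congr orb.
apply/eqP/eqP => [->//|e]; have eA : (x \in A) = (y \in A) by rewrite -!gA e.
move: e; rewrite /g -eA; case: ifPn => xA.
  by move=> /rank_inj; apply; rewrite -?eA.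
by move=> /addnI /rank_inj; apply; rewrite inE -?eA.
Qed.

(** * The two jumps of the speed *)

Section Jumps.
Variables (P : poset_property) (hP : hereditary P) (n : nat) (n0 : 0 < n).

Section SmallSpeed.
Hypothesis small : speed P n < n.

Lemma small_speed_no_linear_family d (T : finPOrderType d) : P T ->
  no_linear_family (T := T) n.
Proof.
move=> PT; have no : ~ n <= speed P n by rewrite leqNgt small.
split.
- by move=> f A B aA nA nB h; apply/no/(speed_dominated hP PT aA nA nB h).
- by move=> A C aA cC nA nC u;
  apply/no/(speed_antichain_chain hP PT aA cC u nA nC).
- move=> f z A aA nD; rewrite ltnNge; apply/negP => nI.
  exact/no/(speed_antichain_split hP PT aA nD nI).
- move=> f z C cC nD; rewrite ltnNge; apply/negP => nI.
  exact/no/(speed_chain_split hP PT cC nD nI).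
- move=> c z C cC cC' cz nD; rewrite ltnNge; apply/negP => nU.
  exact/no/(speed_chain_twin hP PT cC cC' cz nD nU).
Qed.

Lemma small_speed_no_matching_extra d (T : finPOrderType d) :
  P T -> no_matching_extra (T := T) n.
Proof.
move=> PT; have no : ~ n <= speed P n by rewrite leqNgt small.
split.
- by move=> f z X q p m nX h; apply/no/(speed_matching_cone hP PT n0 m nX h).
- move=> Q X q p m nX cQ bQ u.
  exact/no/(speed_matching_branching hP PT n0 m nX cQ bQ u).
Qed.

Lemma small_speed_no_two_chains_extra d (T : finPOrderType d) :
  P T -> no_two_chains_extra (T := T) n.
Proof.
move=> PT; have no : ~ n <= speed P n by rewrite leqNgt small.
split.
- move=> e z C1 C2 c1 c2 u n1 n2 zC h.
  exact/no/(speed_two_chains_point hP PT n0 c1 c2 u n1 n2 zC h).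
- move=> y z D C1 C2 c1 c2 u n1 n2 sD nD hD yz h.
  exact/no/(speed_two_chains_twin hP PT n0 c1 c2 u n1 n2 sD nD hD yz h).
- move=> w z D I cD cI u nD nI hD hI h.
  exact/no/(speed_two_chains_zigzag hP PT n0 cD cI u nD nI hD hI h).
Qed.

End SmallSpeed.

(** Below n./2.+1 both half families are absent in size n, which leaves the
    posets with a large module. *)
Lemma speed_jump_bounded : speed P n < n./2.+1 -> exists B, forall m,
  speed P m <= B.
Proof.
move=> small; have small' : speed P n < n by lia.
set L := module_bound n n.
exists #|{: bool * 'I_L.+1 * {set 'I_L.+1 * 'I_L.+1}}| => m.
apply: (@speed_le _ _ _ (fun c => rel_set m (module_rel c))) => d T PT cT.
have [[kind [M [hM cM]]]|[[X [q [p [hm nX]]]]|[C1 [C2 [c1 c2 u n1 n2]]]]] :=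
  module_or_half_family n0 (small_speed_no_linear_family small' PT) n.
- exact: (module_code cT hM cM).
- by have := speed_matching hP PT hm nX; rewrite leqNgt small.
- by have := speed_two_chains hP PT c1 c2 u n1 n2; rewrite leqNgt small.
Qed.

(** The matchings and the unions of two chains cannot both be present, so that a
    single half family is to be counted besides the posets with a large
    module. *)
Lemma speed_jump_half : speed P n < n ->
  exists B, forall m, speed P m <= B + m./2.+1.
Proof.
move=> small; set K := 19 * n.
set L := module_bound n K.
exists #|{: bool * 'I_L.+1 * {set 'I_L.+1 * 'I_L.+1}}| => m.
have count (R : nat -> rel nat) : (forall d (T : finPOrderType d), P T ->
  #|T| = m ->
    (exists kind M, homogeneous (T := T) kind M /\ #|~: M| <= L) \/
    (exists k : 'I_m./2.+1, rel_set m (R k) \in iso_class m T)) ->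
    speed P m <= #|{: bool * 'I_L.+1 * {set 'I_L.+1 * 'I_L.+1}}| + m./2.+1.
  move=> h; rewrite -[m./2.+1 in leqRHS]card_ord -card_sum.
  apply: (@speed_le _ _ _ (fun c : _ + 'I_m./2.+1 => match c with
    | inl c => rel_set m (module_rel c) | inr k => rel_set m (R k) end)).
  move=> d T PT cT; have [[kind [M [hM cM]]]|[k hk]] := h d T PT cT.
    by have [c hc] := module_code cT hM cM; exists (inl c).
  by exists (inr k).
have split d (T : finPOrderType d) : P T ->
  (exists kind M, homogeneous (T := T) kind M /\ #|~: M| <= L) \/
  has_matching (T := T) K \/ has_two_chains (T := T) K.
  by move=> PT; apply: module_or_half_family n0
    (small_speed_no_linear_family small PT) K.
have [[d1 [T1 [PT1 [C1 [C2 [c1 c2 u n1 n2]]]]]]|no] := pselect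
    (exists d (T : finPOrderType d), P T /\ has_two_chains (T := T) K).
  apply: (count two_chains_rel) => d T PT cT.
  have [h|[[X [q [p [hm nX]]]]|[D1 [D2 [h1 h2 h3 h4 h5]]]]] := split d T PT;
    first by left.
    have : n <= speed P n; last by rewrite leqNgt small.
    by apply: (speed_matching_and_chains hP n0 PT PT1 hm _ c1 c2 u); lia.
  right; have [|C hC] := two_chains_exact n0
    (small_speed_no_two_chains_extra small PT).
    by exists D1, D2; split => //; lia.
  exact: (two_chains_code cT hC).
apply: (count matching_rel) => d T PT cT.
have [h|[h|h]] := split d T PT; first by left.
  right; apply: (matching_code cT).
  exact: matching_exact n0 (small_speed_no_linear_family small PT)
    (small_speed_no_matching_extra small PT) h.
by case: no; exists d, T.
Qed.

End Jumps.

(** * Extremal properties *)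

Section RelPoset.
Variables (T : finType) (r : rel T).
Hypotheses (rr : reflexive r) (ra : antisymmetric r) (rt : transitive r).

(** The proofs of the order axioms are parameters of the type so that the order
    can be attached to it as a canonical structure. *)
Definition rel_poset of reflexive r & antisymmetric r & transitive r : Type :=
  T.
Local Notation rp := (rel_poset rr ra rt).
HB.instance Definition _ := Finite.on rp.
HB.instance Definition _ := Order.Le_isPOrder.Build (Order.Disp tt tt) rp rr ra
  rt.

Lemma rel_posetE (x y : rp) : (x <= y)%O = r x y.
Proof. by []. Qed.
End RelPoset.

Lemma card_half_prod n (b : bool) :
  #|[set p : bool * 'I_n | p.1 == b]| = n.
Proof.
have -> : [set p : bool * 'I_n | p.1 == b] = setX [set b] [set: 'I_n].
  by apply/setP=> p; rewrite !inE andbT.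
by rewrite cardsX cards1 cardsT card_ord mul1n.
Qed.

Definition two_chains_property : poset_property := fun d T =>
  exists C : {set T}, forall x y : T, cmp x y = ((x \in C) == (y \in C)).

Definition cut_property : poset_property := fun d T =>
  exists A : {set T}, forall x y : T, (x < y)%O = (x \in A) && (y \notin A).

Lemma two_chains_large n : exists (d : Order.disp_t) (T : finPOrderType d)
  (C : {set T}), [/\ forall x y : T, cmp x y = ((x \in C) == (y \in C)),
    n <= #|C| & n <= #|~: C|].
Proof.
pose r : rel (bool * 'I_n) := fun p q => (p.1 == q.1) && (p.2 <= q.2).
have rr : reflexive r by move=> p; rewrite /r eqxx leqnn.
have ra : antisymmetric r.
  move=> [a i] [b j]; rewrite /r /= => /andP[/andP[/eqP-> ij] /andP[_ ji]].
  by congr pair; apply/val_inj/eqP; rewrite eqn_leq ij.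
have rt : transitive r.
  move=> [b j] [a i] [c k]; rewrite /r /= => /andP[/eqP-> ij] /andP[/eqP-> jk].
  by rewrite eqxx (leq_trans ij).
exists (Order.Disp tt tt), (rel_poset rr ra rt), [set p | p.1 == true].
split; last first.
- have -> : ~: [set p : rel_poset rr ra rt | p.1 == true] =
  [set p | p.1 == false].
    by apply/setP=> p; rewrite !inE; case: p.1.
  by rewrite card_half_prod.
- by rewrite card_half_prod.
move=> x y; rewrite !inE /Order.comparable !rel_posetE /r.
by case: (x.1); case: (y.1); rewrite //= leq_total.
Qed.

Lemma cut_large n : exists (d : Order.disp_t) (T : finPOrderType d)
  (A : {set T}), [/\ forall x y : T, (x < y)%O = (x \in A) && (y \notin A),
    n <= #|A| & n <= #|~: A|].
Proof.
pose r : rel (bool * 'I_n) := fun p q => (p == q) || (p.1 && ~~ q.1).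
have rr : reflexive r by move=> p; rewrite /r eqxx.
have ra : antisymmetric r.
  move=> p q; rewrite /r (eq_sym q) => /andP[]; case: eqP => //= _.
  by case: p.1; case: q.1.
have rt : transitive r.
  move=> q p s; rewrite /r => /orP[/eqP->//|/andP[hp hq]] /orP[/eqP<-|].
    by rewrite hp hq orbT.
  by rewrite (negPf hq).
exists (Order.Disp tt tt), (rel_poset rr ra rt), [set p | p.1 == true].
split; last first.
- have -> : ~: [set p : rel_poset rr ra rt | p.1 == true] =
  [set p | p.1 == false].
    by apply/setP=> p; rewrite !inE; case: p.1.
  by rewrite card_half_prod.
- by rewrite card_half_prod.
move=> x y; rewrite !inE lt_neqAle rel_posetE /r.
by case: eqP => [->|_] /=; [case: y.1 | case: x.1; case: y.1].
Qed.

Lemma two_chains_hereditary : hereditary two_chains_property.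
Proof.
split.
- move=> d d' T T' [f [g fK gK] fm] [C hC]; exists [set y | g y \in C] => x y.
  by rewrite !inE -hC -(mono_cmp fm) !gK.
- move=> d T A [C hC]; exists [set u | val u \in C] => x y.
  by rewrite !inE -hC.
- move=> n; have [d [T [C [hC nC _]]]] := two_chains_large n.
  exists d, T; split; first by exists C.
  exact: leq_trans nC (max_card _).
Qed.

Lemma cut_hereditary : hereditary cut_property.
Proof.
split.
- move=> d d' T T' [f [g fK gK] fm] [C hC]; exists [set y | g y \in C] => x y.
  by have := mono_dlt true fm (g x) (g y); rewrite /dlt !gK !inE -hC.
- move=> d T A [C hC]; exists [set u | val u \in C] => x y.
  by rewrite !inE -hC.
- move=> n; have [d [T [C [hC nC _]]]] := cut_large n.
  exists d, T; split; first by exists C.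
  exact: leq_trans nC (max_card _).
Qed.

Lemma two_chains_speed n : speed two_chains_property n = n./2.+1.
Proof.
apply/eqP; rewrite eqn_leq; apply/andP; split.
  rewrite -[leqRHS]card_ord.
  apply: (@speed_le _ _ _
    (fun k => rel_set n (two_chains_rel (k : 'I_n./2.+1)))).
  by move=> d T [C hC] cT; apply: two_chains_code hC.
have [d [T [C [hC nC nD]]]] := two_chains_large n.
apply: (speed_two_chains two_chains_hereditary _ _ _ _ nC nD).
- by exists C.
- by move=> x y xC yC; rewrite hC xC yC.
- by move=> x y; rewrite !inE hC => /negPf-> /negPf->.
- by move=> x y xC; rewrite inE hC xC => /negPf->.
Qed.

Lemma cut_speed n : 0 < n -> speed cut_property n = n.
Proof.
move=> n0; apply/eqP; rewrite eqn_leq; apply/andP; split.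
  rewrite -[leqRHS]card_ord.
  apply: (@speed_le _ _ _ (fun k => rel_set n (cut_rel (k : 'I_n)))).
  by move=> d T [C hC] cT; apply: cut_code hC.
have [d [T [A [hA nA nB]]]] := cut_large n.
apply: (speed_dominated cut_hereditary _ _ nA nB (f := true)).
- by exists A.
- move=> x y xA yA; rewrite (cmp_dlt true) /= !hA xA yA /=.
  by rewrite orbF => /eqP.
- by move=> x y xA; rewrite inE /= hA xA.
Qed.

Theorem theorem1 :
  (forall P : poset_property, hereditary P ->
     unbounded (fun n => (speed P n)%:Z%R) ->
     (forall n : nat, 0 < n -> uphalf n.+1 <= speed P n) /\
     (unbounded (fun n => ((speed P n)%:Z - (uphalf n.+1)%:Z)%R) ->
      forall n : nat, 0 < n -> n <= speed P n)) /\
  (exists P : poset_property,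
     [/\ hereditary P,
         unbounded (fun n => (speed P n)%:Z%R) &
         forall n : nat, 0 < n -> speed P n = uphalf n.+1]) /\
  (exists P : poset_property,
     [/\ hereditary P,
         unbounded (fun n => (speed P n)%:Z%R),
         unbounded (fun n => ((speed P n)%:Z - (uphalf n.+1)%:Z)%R) &
         forall n : nat, 0 < n -> speed P n = n]).
Proof.
split; [|split].
- move=> P hP ub.
  have lower n : 0 < n -> uphalf n.+1 <= speed P n.
    move=> n0; rewrite leqNgt; apply/negP => /(speed_jump_bounded hP n0)[B hB].
    by have [m _] := ub B; have := hB m; lia.
  split=> // ub' n n0; rewrite leqNgt; apply/negP
    => /(speed_jump_half hP n0)[B hB].
  by have [m m0] := ub' B; have := hB m; have := lower m m0; lia.
- exists two_chains_property; split; first exact: two_chains_hereditary.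
  + by move=> M; exists (2 * M).+2 => //; rewrite two_chains_speed; lia.
  + by move=> n _; rewrite two_chains_speed.
- exists cut_property; split; first exact: cut_hereditary.
  + by move=> M; exists M.+1 => //; rewrite cut_speed.
  + by move=> M; exists (2 * M).+4 => //; rewrite cut_speed //; lia.
  + exact: cut_speed.
Qed.
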